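(* Let $D=D(h_1,h_2)$ be a monocircular diagram with $h_1,h_2\ge2$. Let $\mu,\mu'$ be odd integers with $1\le\mu<h_1$ and $1\le\mu'<h_2$, so that $V(\mu,0)$ and $V(0,\mu')$ define order two torsion elements in the Khovanov homology of $D$. Then $V(\mu,0)$ and $V(0,\mu')$ define the same torsion element if and only if $\mu=\mu'=1$.
   Context: Khovanov complex (coefficients in $\mathbb Z$). A Kauffman state of a diagram $D$ is a map $s:\mathrm{Cro}(D)\to\{A,B\}$ on the set of crossings. $sD$ denotes the collection of disjoint simple closed curves (''circles'') obtained by smoothing each crossing according to its label, where the $A$-smoothing joins the two regions swept by rotating the overstrand counterclockwise and the $B$-smoothing joins the other two; at each crossing one keeps a small chord (''scar'') joining the two resulting arcs, blue for an $A$-label and red for a $B$-label. An enhanced state is a state together with a sign $\pm$ on each circle of $sD$; $\theta(s)=\#(+)-\#(-)$, $i(s)=$ number of $B$-labels, $j(s)=i(s)+\theta(s)$. $C^{i,j}(D)$ is the free module generated by enhanced states with $i(s)=i$, $j(s)=j$. An enhanced state $t$ is adjacent to $s$ if $i(t)=i(s)+1$, $j(t)=j(s)$, the labels agree except at one crossing $x$ where $s(x)=A$, $t(x)=B$, and the signs of the common circles agree (so mergings are $(+,+)\mapsto +$, $(+,-),(-,+)\mapsto -$, and splittings are $+\mapsto(+,-)$ or $(-,+)$, $-\mapsto(-,-)$). With the crossings numbered, $d(s)=\sum_t (-1)^{k(s,t)}t$ over all $t$ adjacent to $s$, where $k(s,t)$ is the number of crossings previous to the change crossing $x$ having a $B$-label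 in $s$. $\underline{Kh}^{i,j}(D)$ is the homology of $(C^{*,j}(D),d)$ in degree $i$. Monocircular diagrams. A (blue) ladder of height $h$ in $sD$ is a maximal disc containing exactly two arcs of circles and $h$ parallel blue scars (steps) joining them. The monocircular diagram $D(h_1,h_2)$ is the standard diagram of the pretzel link $P(-1,\stackrel{(h_1)}{\dots},-1,h_2)$ (with the convention that the $A$-smoothing of a positive column yields two vertical arcs); with $s_A$ the all-$A$ state, $s_AD$ consists of one circle with two blue ladders $H_1,H_2$ of heights $h_1,h_2$ (one inside the circle, from the $h_1$ crossings of the $-1$ columns, or outside, and the other, from the $h_2$ column, on the opposite side, with interleaved endpoints) and no other scars. Crossings are ordered: first the steps of $H_1$ in order along the ladder, then those of $H_2$. Notation (initial state $s_A$). For nonempty $M_i\subset\{1,\dots,h_i\}$ with $|M_i|=\mu_i$, $s(M_1,M_2;\,)$ is the Kauffman state obtained from $s_A$ by changing the steps in $M_i$ of $H_i$ to red ($B$). Cutting both ladders (replacing the two arcs of each by caps at its two ends) leaves a single circle, which touches both ends of both ladders; the corresponding circle in the smoothing of $s(M_1,M_2;\,)$, touching the first (and last) red step of $H_i$, is denoted $C_i^0$. $s(\mu_1,\mu_2;C_i^{0-})$ is the sum, over all $M_1,M_2$ with $|M_t|=\mu_t$, of the enhanced states with underlying state $s(M_1,M_2;\,)$ in which all circles have sign $+$ except $C_i^0$, which has sign $-$. For $\mu$ odd, $V(0,\mu):=s(1,\mu;C_2^{0-})$ if $1\le\mu<h_2$, and $V(\mu,0):=(-1)^\mu s(\mu,1;C_1^{0-})$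 if $1\le\mu<h_1$. It is a known result that these define order two torsion elements in $\underline{Kh}^{\mu+1,2\mu-1}(D)$. *)

(* Defs.v *)
(* boolp is used only to decide membership in the image of the differential. *)
From HB Require Import structures.
From mathcomp Require Import all_boot all_order all_algebra.
From mathcomp Require Import boolp.

Set Implicit Arguments.
Unset Strict Implicit.
Unset Printing Implicit Defensive.

Import Order.TTheory GRing.Theory Num.Theory.
Local Open Scope ring_scope.
Local Open Scope quotient_scope.

(* A link diagram with at least one crossing on each component, as a planar
   diagram code: the arcs are the edges of the underlying 4-valent plane graph,
   and the ends at the crossing x are [corners x = (a, b, c, d)], read
   counterclockwise and starting from an end of the understrand; so a - c is the
   understrand and b - d the overstrand. The numbering of the crossings is that
   of ['I_(ncro D)]. *)
Record diagram := Diagram {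
  ncro : nat;
  arc : finType;
  corners : 'I_ncro -> arc * arc * arc * arc
}.

Section Khovanov.
Variable D : diagram.

(* The label [false] is A and the label [true] is B. *)
Definition kstate := {ffun 'I_(ncro D) -> bool}.

(* Rotating the overstrand b - d counterclockwise sweeps the regions between
   b and c and between d and a. Joining them (A-smoothing) leaves the curves
   a - b and c - d; joining the two other regions (B-smoothing) leaves the
   curves a - d and b - c. *)
Definition smoothing (s : kstate) (x : 'I_(ncro D)) : seq (arc D * arc D) :=
  let: (a, b, c, d) := corners x in
  if s x then [:: (a, d); (b, c)] else [:: (a, b); (c, d)].

Definition joined (s : kstate) : rel (arc D) := fun e f =>
  [exists x, ((e, f) \in smoothing s x) || ((f, e) \in smoothing s x)].

(* A circle of sD is represented by the set of the arcs which it runs through. *)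
Definition circle_through (s : kstate) (e : arc D) : {set arc D} :=
  [set f | connect (joined s) e f].

Definition circles (s : kstate) : {set {set arc D}} :=
  [set circle_through s e | e : arc D].

(* An enhanced state: a state together with the set of its circles of sign +. *)
Definition estate :=
  {S : kstate * {set {set arc D}} | S.2 \subset circles S.1}.

Definition lab (S : estate) : kstate := (val S).1.
Definition plus (S : estate) : {set {set arc D}} := (val S).2.

Definition theta (S : estate) : int :=
  #|plus S|%:Z - #|circles (lab S) :\: plus S|%:Z.
Definition ideg (S : estate) : int := #|[set x | lab S x]|%:Z.
Definition jdeg (S : estate) : int := ideg S + theta S.

(* T is adjacent to S, with change crossing x. *)
Definition adjacent_at (x : 'I_(ncro D)) (S T : estate) : bool :=
  [&& ideg T == ideg S + 1,
      jdeg T == jdeg S,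
      ~~ lab S x,
      lab T x,
      [forall y, (y != x) ==> (lab T y == lab S y)]
    & [forall C in circles (lab S) :&: circles (lab T),
        (C \in plus S) == (C \in plus T)]].

(* The sum has at most one term. *)
Definition incidence (S T : estate) : int :=
  \sum_(x | adjacent_at x S T)
    (-1) ^+ #|[set y : 'I_(ncro D) | (y < x)%N && lab S y]|.

Definition chain := {ffun estate -> int}.

Definition dif (c : chain) : chain :=
  [ffun T => \sum_S c S * incidence S T].

Lemma dif_is_zmod_morphism : zmod_morphism dif.
Proof.
move=> c c'; apply/ffunP=> T; rewrite !ffunE -sumrB; apply: eq_bigr => S _.
by rewrite !ffunE mulrBl.
Qed.
HB.instance Definition _ :=
  GRing.isZmodMorphism.Build chain chain dif dif_is_zmod_morphism.

(* C^{i,j}, as the submodule of [chain] spanned by the states of bidegree (i, j). *)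
Definition chains (i j : int) : {pred chain} := fun c =>
  [forall S, (c S != 0) ==> (ideg S == i) && (jdeg S == j)].

Lemma chainsP i j (c : chain) :
  reflect (forall S, ~~ ((ideg S == i) && (jdeg S == j)) -> c S = 0)
    (c \in chains i j).
Proof.
apply: (iffP forallP) => [h S nS|h S].
  by apply/eqP; apply: contraNT nS => nz; exact: (implyP (h S) nz).
by apply/implyP; apply: contraNT => /h ->.
Qed.

Lemma chains_zmod_closed i j : zmod_closed (chains i j).
Proof.
split=> [|c c' /chainsP hc /chainsP hc']; apply/chainsP=> S nS.
  by rewrite ffunE.
by rewrite !ffunE hc // hc' // subr0.
Qed.
HB.instance Definition _ i j :=
  GRing.isZmodClosed.Build chain (chains i j) (chains_zmod_closed i j).

Definition cycles (i j : int) : {pred chain} := fun c =>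
  (c \in chains i j) && (dif c == 0).

Lemma cycles_zmod_closed i j : zmod_closed (cycles i j).
Proof.
split=> [|c c' /andP[hc /eqP dc] /andP[hc' /eqP dc']]; apply/andP; split.
- exact: rpred0.
- by rewrite raddf0.
- exact: rpredB.
- by rewrite raddfB /= dc dc' subr0.
Qed.
HB.instance Definition _ i j :=
  GRing.isZmodClosed.Build chain (cycles i j) (cycles_zmod_closed i j).

Record kcycle (i j : int) := Cycle {
  cycle_chain :> chain;
  _ : cycle_chain \in cycles i j
}.
HB.instance Definition _ i j := [isSub for @cycle_chain i j].
HB.instance Definition _ i j := [Choice of kcycle i j by <:].
HB.instance Definition _ i j := [SubChoice_isSubZmodule of kcycle i j by <:].

Definition boundaries (i j : int) : {pred kcycle i j} := fun z =>
  `[< exists2 c, c \in chains (i - 1) j & dif c = z >].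

Lemma boundaries_zmod_closed i j : zmod_closed (@boundaries i j).
Proof.
split=> [|z z' /asboolP[c hc dc] /asboolP[c' hc' dc']]; apply/asboolP.
  by exists 0; [exact: rpred0 | rewrite raddf0].
by exists (c - c'); [exact: rpredB | rewrite raddfB /= dc dc'].
Qed.
HB.instance Definition _ i j :=
  GRing.isZmodClosed.Build (kcycle i j) (@boundaries i j)
    (boundaries_zmod_closed i j).

Definition Kh (i j : int) : zmodType := Quotient.quot (@boundaries i j).

Definition defines (c : chain) (i j : int) (k : Kh i j) : Prop :=
  exists z : kcycle i j, (z : chain) = c /\ \pi_(Kh i j) z = k.

(* The enhanced state with underlying state s, all of whose circles have sign +
   except C. *)
Lemma minus_at_subproof (s : kstate) (C : {set arc D}) :
  circles s :\ C \subset circles s.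
Proof. exact: subD1set. Qed.
Definition minus_at (s : kstate) (C : {set arc D}) : estate :=
  exist _ (s, circles s :\ C) (minus_at_subproof s C).

Definition gen (S : estate) : chain := [ffun T => (T == S)%:R].

End Khovanov.

Section Monocircular.
Variables h1 h2 : nat.

(* The diagram of P(-1, .., -1, h2): h1 columns with one crossing each, followed
   on their right by a column of h2 crossings, consecutive columns being joined
   at the top and at the bottom, and the last one to the first one by arcs going
   around the diagram.

            top 0     top 1          top h1 = lft 0   rgt 0 = top 0
        ...------\   /-----\   /- ... ---------\   /------...
                  (0)       (1)                 (0)
                 /   \     /   \           lft 1   rgt 1
        ...------     -----     - ...           (1)
            bot 0     bot 1                     ...
                              bot h1 = lft h2   rgt h2 = bot 0

   The 2 (h1 + h2) arcs are numbered cyclically along the single circle of the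
   all-A state: rightwards along the top of the h1 columns, downwards along the
   left of the last column, leftwards along the bottom of the h1 columns and
   upwards along the right of the last column. *)
Definition mono_arc : finType := 'Z_(2 * (h1 + h2)).
Definition top (k : nat) : mono_arc := (k%:R : 'Z_(2 * (h1 + h2))).
Definition bot (k : nat) : mono_arc := (- (h2 + k)%:R : 'Z_(2 * (h1 + h2))).
Definition lft (m : nat) : mono_arc := ((h1 + m)%:R : 'Z_(2 * (h1 + h2))).
Definition rgt (m : nat) : mono_arc := (- m%:R : 'Z_(2 * (h1 + h2))).

(* A crossing of the -1 columns has overstrand NW - SE, and is read NE, NW, SW,
   SE; its A-smoothing gives two horizontal curves. A crossing of the h2 column
   has overstrand SW - NE, and is read NW, SW, SE, NE; its A-smoothing gives two
   vertical curves. The crossings of the first kind are numbered first. *)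
Definition mono_corners (x : 'I_(h1 + h2)) :
    mono_arc * mono_arc * mono_arc * mono_arc :=
  match split x with
  | inl k => (top k.+1, top k, bot k, bot k.+1)
  | inr m => (lft m, lft m.+1, rgt m.+1, rgt m)
  end.

Definition mono : diagram := @Diagram (h1 + h2) mono_arc mono_corners.

(* s(M1, M2; ) *)
Definition red_steps (M1 : {set 'I_h1}) (M2 : {set 'I_h2}) :
    kstate mono :=
  [ffun x : 'I_(h1 + h2) =>
    match split x with inl k => k \in M1 | inr m => m \in M2 end].

Definition first_step h (M : {set 'I_h}) : nat :=
  find (fun k => k \in M) (enum 'I_h).

(* C_1^0 and C_2^0 touch the first red step on its side facing the beginning of
   the ladder: the west side in H_1, the north side in H_2. The NW end of the
   k-th crossing is [top k] in H_1 and [lft k] in H_2. *)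
Definition C10 (M1 : {set 'I_h1}) (M2 : {set 'I_h2}) :
    {set mono_arc} :=
  circle_through (red_steps M1 M2) (top (first_step M1)).
Definition C20 (M1 : {set 'I_h1}) (M2 : {set 'I_h2}) :
    {set mono_arc} :=
  circle_through (red_steps M1 M2) (lft (first_step M2)).

(* s(m1, m2; C_1^{0-}) and s(m1, m2; C_2^{0-}) *)
Definition sC10 (m1 m2 : nat) : chain mono :=
  \sum_(M1 : {set 'I_h1} | #|M1| == m1) \sum_(M2 : {set 'I_h2} | #|M2| == m2)
    gen (minus_at (red_steps M1 M2) (C10 M1 M2)).
Definition sC20 (m1 m2 : nat) : chain mono :=
  \sum_(M1 : {set 'I_h1} | #|M1| == m1) \sum_(M2 : {set 'I_h2} | #|M2| == m2)
    gen (minus_at (red_steps M1 M2) (C20 M1 M2)).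

(* V(mu, 0) and V(0, mu), for mu odd with 1 <= mu < h1, resp. 1 <= mu < h2 *)
Definition Vl (mu : nat) : chain mono := sC10 mu 1 *~ ((-1) ^+ mu).
Definition Vr (mu : nat) : chain mono := sC20 1 mu.

End Monocircular.

(* Main.v *)
From Pilot Require Import Defs.
From HB Require Import structures.
From mathcomp Require Import all_boot all_order all_algebra.
From mathcomp Require Import boolp.
From mathcomp Require Import zify ring.
(* so that [arc] is that of a diagram, not the piece of a cycle of [path] *)
Import Pilot.Defs.

Set Implicit Arguments.
Unset Strict Implicit.
Unset Printing Implicit Defensive.

Import Order.TTheory GRing.Theory Num.Theory.
Local Open Scope ring_scope.

(** Write [Z(M1, M2)] for the enhanced state on the steps [M1], [M2] whose only
    minus circle is the outer circle, the one through both ends of both ladders.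
    Let [V m1 m2], that is [minus_sum m1 m2 (top 0)], be the sum of the [Z(M1, M2)]
    with [#|M1| = m1] and [#|M2| = m2]. Then [V(mu, 0)] is [- V mu 1] and
    [V(0, mu')] is [V 1 mu']: when both ladders have a red step, [C_1^0] and
    [C_2^0] are both the outer circle.

    Cycles. Making one more step red in a ladder splits a circle. Read
    backwards, the coefficient of an enhanced state [T] in [dif (V m1 m2)] is a
    signed sum over the red steps of [T] in one ladder. [T] only matters if its
    minus circles are the outer one and one other circle [G], and then a step [x]
    contributes 1 for each of its two sides which lies on [G]. Along the ladder
    the far side of a step and the near side of the next one are on the same
    circle while the sign changes, so the sum telescopes to its two ends
    ([telescope_l], [telescope_r]); both ends are on the outer circle, hence the
    sum is 0 ([dif_minus_sum_outer]).

    Equality for [mu = mu' = 1]. With one red step in the second ladder and none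
    in the first, there are two circles, one at each end of the ladder. Take the
    sum of all enhanced states of this kind with exactly one minus circle. In its
    boundary the splittings telescope to two opposite terms, and each merging
    gives [Z({x}, {y})] once for each of the two circles, so the boundary is
    [2 V 1 1 = V(0, 1) - V(1, 0)] ([dif_minus_sum_caps]).

    Distinctness for [mu' > 1]. A linear form with values in the field with two
    elements vanishes on all boundaries and separates the two chains. Let [I_m]
    consist of the first [m] steps of the second ladder, [m = mu']. The form
    counts the enhanced states on [({first step}, I_m)] with one minus circle,
    and those on [(empty, I_(m+1))] with two minus circles, one of them at the
    far end of the ladder. Splittings reach these states an even number of times,
    except for the one which adds the last step to [(empty, I_m)]; an enhanced state
    on [(empty, I_m)] with one minus circle reaches the first family once by a
    merging and the second one once by that splitting ([pairing_weight_dif]).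
    The form is 1 on [V 1 m] and 0 on [V mu 1]. Hence equality forces [mu' = 1],
    and then [mu = 1] since both chains must have the same degree.

    Two facts about circles carry the computations. Changing one label fuses two
    circles or divides one, according to how the four ends at the crossing are
    joined by the rest of the diagram ([split_fused], [merge_fused]). Two arcs
    are on different circles as soon as some function constant along the circles
    separates them; the number of red steps that precede an arc in its ladder,
    suitably reduced, is one ([glue_invariant]). *)

(** * Connectivity of finite graphs *)

Section Connectivity.
Variable A : finType.
Implicit Types e : rel A.

Lemma connect_least e (R : rel A) :
  reflexive R -> transitive R -> subrel e R -> subrel (connect e) R.
Proof.
move=> Rxx Rtr eR x y /connectP[w ew ->] {y}.
elim: w x ew => [|z w IH] x //= /andP[exz ew].
exact: Rtr (eR _ _ exz) (IH _ ew).
Qed.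

Lemma connect_redundant (e0 e1 : rel A) :
  subrel e0 e1 -> subrel e1 (connect e0) -> connect e1 =2 connect e0.
Proof.
move=> e01 e10 x y; apply/idP/idP.
  exact: (connect_least (connect0 _) (@connect_trans _ _) e10).
by apply: connect_sub => {}x {}y /e01/connect1.
Qed.

(** [e1] adds to [e0] edges inside the union [W] of two components, one of
    which links the two. *)
Lemma connect_fuse (e0 e1 : rel A) u v :
    connect_sym e0 -> subrel e0 e1 -> connect_sym e1 -> connect e1 u v ->
    let W := [pred x | connect e0 u x || connect e0 v x] in
    (forall x y, e1 x y -> connect e0 x y || W x && W y) ->
  forall x y, connect e1 x y = connect e0 x y || W x && W y.
Proof.
move=> sym0 e01 sym1 uv W e1W x y.
have sub01 : subrel (connect e0) (connect e1).
  by apply: connect_sub => {}x {}y /e01/connect1.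
have Wu z : W z -> connect e1 u z.
  by case/orP=> /sub01 // vz; apply: connect_trans vz.
have Wcl crossing1 x2 : connect e0 crossing1 x2 -> W crossing1 -> W x2.
  by move=> c /orP[] c'; apply/orP; [left|right]; apply: connect_trans c' c.
apply/idP/idP.
  apply: (@connect_least _ (fun x y => connect e0 x y || W x && W y)) => //.
    by move=> z; rewrite connect0.
  move=> z1 z2 z3 /orP[c12|/andP[w2 w1]] /orP[c13|/andP[w1' w3]].
  - by rewrite (connect_trans c12 c13).
  - by rewrite w3 andbT (Wcl z1) ?orbT // sym0.
  - by rewrite w2 (Wcl _ _ c13 w1) orbT.
  - by rewrite w2 w3 orbT.
case/orP=> [/sub01 //|/andP[/Wu ux /Wu uy]].
by apply: connect_trans uy; rewrite sym1.
Qed.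

End Connectivity.

(** * Circles of a state, and how one crossing changes them *)

Section Circles.
Variable D : diagram.
Implicit Types (s t : kstate D) (S T : estate D) (e f u v : arc D) (x : 'I_(ncro D)).

Lemma joined_connect_sym s : connect_sym (joined s).
Proof.
apply: sym_connect_sym => e f; apply/existsP/existsP=> -[x];
by rewrite orbC; exists x.
Qed.

Lemma mem_circle s e f : (f \in circle_through s e) = connect (joined s) e f.
Proof. by rewrite inE. Qed.

Lemma mem_circle_self s e : e \in circle_through s e.
Proof. by rewrite inE. Qed.

Lemma circle_sym s e f : (f \in circle_through s e) = (e \in circle_through s f).
Proof. by rewrite !inE joined_connect_sym. Qed.

Lemma eq_circle s e f :
  (circle_through s e == circle_through s f) = (f \in circle_through s e).
Proof.
apply/eqP/idP=> [->|]; first exact: mem_circle_self.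
rewrite inE => c; apply/setP=> g; rewrite !inE.
exact: same_connect (@joined_connect_sym s) _ _ c g.
Qed.

Lemma circle_eq s e f : f \in circle_through s e -> circle_through s e = circle_through s f.
Proof. by rewrite -eq_circle => /eqP. Qed.

Lemma circle_in s e : circle_through s e \in circles s.
Proof. exact: imset_f. Qed.

Definition removed t x : kstate D := [ffun y => (y != x) && t y].

Lemma removedE t x y : removed t x y = (y != x) && t y.
Proof. by rewrite ffunE. Qed.

(** This is the same graph for both labels of [x], so it serves to compare the
    circles of the two states. *)
Definition away t x : rel (arc D) := fun e f =>
  [exists y, (y != x) &&
     (((e, f) \in smoothing t y) || ((f, e) \in smoothing t y))].

Lemma away_connect_sym t x : connect_sym (away t x).
Proof.
apply: sym_connect_sym => e f; apply/existsP/existsP=> -[y /andP[nyx h]];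
by exists y; rewrite nyx orbC.
Qed.

Lemma away_removed t x : away (removed t x) x =2 away t x.
Proof.
move=> e f; apply: eq_existsb => y; case: eqP => //= /eqP nyx.
by rewrite /smoothing removedE nyx.
Qed.

Lemma joined_away t x e f :
  joined t e f = away t x e f
    || (((e, f) \in smoothing t x) || ((f, e) \in smoothing t x)).
Proof.
apply/existsP/orP=> [[y h]|[/existsP[y /andP[_ h]]|h]]; last 2 first.
- by exists y.
- by exists x.
case: (eqVneq y x) => [<-|nyx]; first by right.
by left; apply/existsP; exists y; rewrite nyx.
Qed.

Lemma away_edge t x y (a b : arc D) : y != x -> (a, b) \in smoothing t y ->
  connect (away t x) a b.
Proof. by move=> nyx h; apply/connect1/existsP; exists y; rewrite nyx h. Qed.

Lemma joined_edge t x (a b : arc D) : (a, b) \in smoothing t x -> connect (joined t) a b.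
Proof. by move=> h; apply/connect1/existsP; exists x; rewrite h. Qed.

(** One notion for both directions of the differential: a splitting at a
    crossing has [t] as its target, a merging has [t] as its source. *)
Definition fused t s u v :=
  v \notin circle_through t u /\
  (forall e, circle_through s e =
     if (e \in circle_through t u) || (e \in circle_through t v)
     then circle_through t u :|: circle_through t v else circle_through t e).

Lemma fused_of_connect t s u v :
    ~~ connect (joined t) u v ->
    (forall e f, connect (joined s) e f = connect (joined t) e f ||
       [pred x | connect (joined t) u x || connect (joined t) v x] e &&
       [pred x | connect (joined t) u x || connect (joined t) v x] f) ->
  fused t s u v.
Proof.
move=> nuv H; split; first by rewrite inE.
move=> e; apply/setP=> f; rewrite inE H /= (fun_if (fun B : {set _} => f \in B)) !inE.
case: ifP => [We|]; last by rewrite orbF.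
have sym := @joined_connect_sym t.
case: (boolP (connect _ e f)) => //= ef; apply/esym.
by case/orP: We => /connect_trans/(_ ef) ->; rewrite ?orbT.
Qed.

Lemma fusedC t s u v : fused t s u v -> fused t s v u.
Proof.
move=> [nuv H]; split; first by rewrite circle_sym.
by move=> e; rewrite H orbC setUC.
Qed.

Lemma fused_repr t s u v u' v' :
  fused t s u v -> u' \in circle_through t u -> v' \in circle_through t v ->
  fused t s u' v'.
Proof.
move=> [uv F] uu' vv'; split; last by move=> e; rewrite F -(circle_eq uu') -(circle_eq vv').
by rewrite -(circle_eq uu') circle_sym -(circle_eq vv') circle_sym.
Qed.

(** The B-smoothing only joins ends which are already joined away from [x], so
    the circles of [t] are the components of the graph away from [x]; the
    A-smoothing adds the link between [a] and [b]. *)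
Lemma split_fused t x a b c d :
    corners x = (a, b, c, d) -> t x ->
    connect (away t x) a d -> connect (away t x) b c ->
    b \notin circle_through t a ->
  fused t (removed t x) a b.
Proof.
move=> cx tx ad bc; rewrite mem_circle => nab.
have sym := @away_connect_sym t x.
have E : connect (joined t) =2 connect (away t x).
  apply: connect_redundant => e f; rewrite (joined_away t x); first by move=> ->.
  rewrite /smoothing cx tx !inE !xpair_eqE.
  case/orP=> [/connect1 //|].
  by do ![case/orP] => /andP[/eqP-> /eqP->] //; rewrite sym.
apply: fused_of_connect => // e f; rewrite !inE !E.
have eA := eq_connect (away_removed t x).
rewrite -!eA; apply: (@connect_fuse _ _ _ a b).
- exact: away_connect_sym.
- by move=> {}e {}f; rewrite (joined_away _ x) => ->.
- exact: joined_connect_sym.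
- by apply/connect1; rewrite (joined_away _ x) /smoothing cx removedE eqxx !inE eqxx !orbT.
move=> {}e {}f; rewrite !inE !eA.
rewrite (joined_away _ x) away_removed /smoothing cx removedE eqxx !inE !xpair_eqE.
case/orP=> [/connect1 -> //|].
by do ![case/orP] => /andP[/eqP-> /eqP->]; rewrite ?connect0 ?ad ?bc ?orbT.
Qed.

(** The mirror situation: now it is the A-smoothing which is redundant. *)
Lemma merge_fused t x a b c d :
    corners x = (a, b, c, d) -> t x ->
    connect (away t x) a b -> connect (away t x) c d ->
    c \notin circle_through (removed t x) a ->
  fused (removed t x) t a c.
Proof.
move=> cx tx ab cd; rewrite mem_circle => nac.
have sym := @away_connect_sym t x.
have E : connect (joined (removed t x)) =2 connect (away t x).
  apply: connect_redundant => e f; rewrite (joined_away _ x) away_removed; first by move=> ->.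
  rewrite /smoothing cx removedE eqxx !inE !xpair_eqE.
  case/orP=> [/connect1 //|].
  by do ![case/orP] => /andP[/eqP-> /eqP->] //; rewrite sym.
apply: fused_of_connect => // e f; rewrite !inE !E.
apply: (@connect_fuse _ _ _ a c).
- exact: away_connect_sym.
- by move=> {}e {}f; rewrite (joined_away _ x) => ->.
- exact: joined_connect_sym.
- apply: (@connect_trans _ _ d).
    by apply/connect1; rewrite (joined_away _ x) /smoothing cx tx !inE eqxx !orbT.
  rewrite joined_connect_sym; apply: connect_sub cd => {}e {}f ef.
  by apply: connect1; rewrite (joined_away _ x) ef.
move=> {}e {}f; rewrite !inE.
rewrite (joined_away _ x) /smoothing cx tx !inE !xpair_eqE.
case/orP=> [/connect1 -> //|].
by do ![case/orP] => /andP[/eqP-> /eqP->]; rewrite ?connect0 ?ab ?cd ?orbT.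
Qed.

Section Fused.
Variables (t s : kstate D) (u v : arc D).
Hypothesis F : fused t s u v.
Local Notation U := (circle_through t u).
Local Notation V := (circle_through t v).
Local Notation W := (U :|: V).

Lemma fused_in e : e \in W -> circle_through s e = W.
Proof. by rewrite F.2 in_setU => ->. Qed.

Lemma fused_out e : e \notin W -> circle_through s e = circle_through t e.
Proof. by rewrite F.2 in_setU => /negbTE->. Qed.

Lemma fused_neq : U != V.
Proof. by rewrite eq_circle F.1. Qed.

Lemma fused_u : circle_through s u = W.
Proof. by rewrite fused_in // inE mem_circle_self. Qed.

Lemma fused_notin : W \notin circles t.
Proof.
apply/imsetP=> -[e _ WE].
have: u \in W by rewrite inE mem_circle_self.
have: v \in W by rewrite inE mem_circle_self orbT.
rewrite WE => /circle_eq ev /circle_eq eu.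
by have /eqP[] := fused_neq; rewrite -ev -eu.
Qed.

Lemma circle_uv e : e \notin W -> (circle_through t e != U) && (circle_through t e != V).
Proof. by rewrite in_setU negb_or [_ == U]eq_sym [_ == V]eq_sym !eq_circle. Qed.

Lemma fused_circles : circles s = W |: (circles t :\ U :\ V).
Proof.
apply/setP=> C; apply/imsetP/setU1P=> [[e _ ->]|].
  case: (boolP (e \in W)) => We; first by left; exact: fused_in.
  right; rewrite fused_out // !inE circle_in andbT.
  by have /andP[-> ->] := circle_uv We.
case=> [->|]; first by exists u; rewrite ?fused_u.
rewrite !inE => /and3P[nV nU /imsetP[e _ CE]].
exists e => //; rewrite fused_out -?CE // in_setU -!eq_circle.
by rewrite -CE ![_ == C]eq_sym (negbTE nV) (negbTE nU).
Qed.

Lemma fused_card : #|circles t| = #|circles s|.+1.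
Proof.
rewrite fused_circles cardsU1 (cardsD1 U) (cardsD1 V) !inE circle_in.
rewrite eq_sym fused_neq circle_in /= (negbTE fused_notin) !andbF /=.
by rewrite addnA.
Qed.

Lemma fused_common : circles s :&: circles t = circles t :\ U :\ V.
Proof.
rewrite fused_circles; apply/setP=> C; rewrite !inE.
case: (eqVneq C W) => [->|]; last by case: (_ \in circles t); rewrite /= ?andbT ?andbF.
by rewrite (negbTE fused_notin) !andbF.
Qed.

End Fused.

(** * Signs of circles and adjacency *)

(** Signs are read on arcs rather than on circles: the arcs are common to all
    states, the circles are not. *)
Definition sgn S e : bool := circle_through (lab S) e \in plus S.

Definition minus S : {set {set arc D}} := circles (lab S) :\: plus S.

Lemma plus_circles S C : C \in plus S -> C \in circles (lab S).
Proof. exact: (subsetP (valP S)). Qed.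

Lemma sgn_circle S e f : f \in circle_through (lab S) e -> sgn S f = sgn S e.
Proof. by rewrite /sgn => /circle_eq ->. Qed.

Lemma estate_eq S T : lab S = lab T -> sgn S =1 sgn T -> S = T.
Proof.
move=> lST sST; apply: val_inj.
rewrite [LHS]surjective_pairing [RHS]surjective_pairing.
congr (_, _); first exact: lST.
apply/setP=> C; apply/idP/idP=> h.
  have /imsetP[e _ CE] := plus_circles h.
  by have := sST e; rewrite /sgn -lST -CE h => /esym.
have /imsetP[e _ CE] := plus_circles h.
by have := sST e; rewrite /sgn lST -CE h.
Qed.

(** Since a splitting adds a circle and a merging removes one, this turns the
    condition on [theta] into one on the number of minus circles. *)
Lemma theta_minus S : theta S = #|circles (lab S)|%:Z - (#|minus S|.*2)%:Z.
Proof.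
rewrite /theta -(cardsID (plus S) (circles (lab S))) -/(minus S).
have /setIidPr-> : plus S \subset circles (lab S) by exact: (valP S).
lia.
Qed.

Lemma adjacent_lab x S T :
  adjacent_at x S T -> lab T x /\ lab S = removed (lab T) x.
Proof.
case/and5P=> _ _ Sx Tx /andP[/forallP h _]; split=> //.
apply/ffunP=> y; rewrite removedE; case: eqVneq => [->|nyx]; first exact/negbTE.
by have := h y; rewrite nyx => /eqP ->.
Qed.

Lemma adjacentE x S T : lab T x -> lab S = removed (lab T) x ->
  adjacent_at x S T = (theta S == theta T + 1) &&
    [forall C in circles (lab S) :&: circles (lab T), (C \in plus S) == (C \in plus T)].
Proof.
move=> Tx lS; rewrite /adjacent_at /jdeg.
have iT : ideg T = ideg S + 1.
  rewrite /ideg lS (cardsD1 x [set y | lab T y]) inE Tx addrC; congr (_%:Z + _%:Z).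
  by apply: eq_card => y; rewrite !inE removedE.
rewrite iT eqxx lS removedE eqxx Tx /=.
have -> : [forall y, (y != x) ==> (lab T y == removed (lab T) x y)].
  by apply/forallP=> y; apply/implyP=> nyx; rewrite removedE nyx.
by congr (_ && _); apply/eqP/eqP; lia.
Qed.

Lemma fused_agree S T u v :
    fused (lab T) (lab S) u v ->
  reflect (forall e, e \notin circle_through (lab T) u :|: circle_through (lab T) v ->
             sgn S e = sgn T e)
    [forall C in circles (lab S) :&: circles (lab T), (C \in plus S) == (C \in plus T)].
Proof.
move=> F; rewrite (fused_common F); apply: (iffP idP) => [/forall_inP h|h].
  move=> e We; have := h (circle_through (lab T) e).
  rewrite !inE circle_in; have /andP[-> ->] := circle_uv We.
  by rewrite /sgn (fused_out F We) => /(_ isT)/eqP.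
apply/forall_inP=> C; rewrite !inE => /and3P[nV nU /imsetP[e _ CE]].
have We : e \notin circle_through (lab T) u :|: circle_through (lab T) v.
  by rewrite in_setU -!eq_circle -CE ![_ == C]eq_sym (negbTE nV) (negbTE nU).
by have := h e We; rewrite /sgn (fused_out F We) -CE => ->.
Qed.

(** The minus circles away from the fused ones are the same; the identity is
    additive so as to avoid subtractions. *)
Lemma fused_minus S T u v :
    fused (lab T) (lab S) u v ->
    (forall e, e \notin circle_through (lab T) u :|: circle_through (lab T) v ->
             sgn S e = sgn T e) ->
  (#|minus T| + ~~ sgn S u = #|minus S| + ~~ sgn T u + ~~ sgn T v)%N.
Proof.
move=> F h.
pose U := circle_through (lab T) u; pose V := circle_through (lab T) v.
have E : minus T :\ U :\ V = minus S :\ (U :|: V).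
  apply/setP=> C; rewrite !inE; apply/idP/idP.
    case/and4P=> nV nU CT /imsetP[e _ CE].
    have We : e \notin U :|: V.
      by rewrite in_setU -!eq_circle -CE ![_ == C]eq_sym (negbTE nV) (negbTE nU).
    have <- : circle_through (lab S) e = C by rewrite (fused_out F We).
    rewrite circle_in andbT.
    have := h e We; rewrite /sgn -CE (negbTE CT) => ->; rewrite andbT.
    apply: contraNneq We => <-; exact: mem_circle_self.
  case/and3P=> nW CS /imsetP[e _ CE].
  have We : e \notin U :|: V.
    by apply: contraNN nW => /(fused_in F); rewrite -CE => ->.
  have CE' : circle_through (lab T) e = C by rewrite -(fused_out F We).
  rewrite -CE' circle_in; have /andP[-> ->] := circle_uv We.
  by have := h e We; rewrite /sgn -CE (negbTE CS) => <-.
rewrite (cardsD1 U (minus T)) (cardsD1 V (minus T :\ U)) E.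
rewrite (cardsD1 (U :|: V) (minus S)) !inE /sgn (fused_u F) !circle_in.
rewrite eq_sym (fused_neq F) -(fused_u F) circle_in /= !andbT -/U -/V.
ring.
Qed.

(** Splittings: [+] goes to [(+, -)] or [(-, +)], and [-] to [(-, -)]. *)
Lemma split_adjacent x S T u v :
    lab T x -> lab S = removed (lab T) x -> fused (lab T) (lab S) u v ->
  reflect ((forall e, e \notin circle_through (lab T) u :|: circle_through (lab T) v ->
             sgn S e = sgn T e) /\ (sgn T u + sgn T v = sgn S u)%N)
   (adjacent_at x S T).
Proof.
move=> Tx lS F; rewrite adjacentE // !theta_minus (fused_card F).
apply: (iffP andP) => -[].
  move=> h1 /(fused_agree F) h2; split=> //.
  have := fused_minus F h2; lia.
move=> h1 h2; split; last exact/(fused_agree F).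
have := fused_minus F h1; lia.
Qed.

(** Mergings: [(+, +)] goes to [+], [(+, -)] and [(-, +)] to [-]. *)
Lemma merge_adjacent x S T u v :
    lab T x -> lab S = removed (lab T) x -> fused (lab S) (lab T) u v ->
  reflect ((forall e, e \notin circle_through (lab S) u :|: circle_through (lab S) v ->
             sgn T e = sgn S e) /\ (sgn S u + sgn S v = (sgn T u).+1)%N)
   (adjacent_at x S T).
Proof.
move=> Tx lS F; rewrite adjacentE // !theta_minus (fused_card F).
have -> : [forall C in circles (lab S) :&: circles (lab T), (C \in plus S) == (C \in plus T)]
  = [forall C in circles (lab T) :&: circles (lab S), (C \in plus T) == (C \in plus S)].
  by apply: eq_forallb => C; rewrite setIC eq_sym.
apply: (iffP andP) => -[].
  move=> h1 /(fused_agree F) h2; split=> //.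
  have := fused_minus F h2; lia.
move=> h1 h2; split; last exact/(fused_agree F).
have := fused_minus F h1; lia.
Qed.

Lemma estate_of_signs_subproof t (sg : pred (arc D)) :
  [set circle_through t e | e in sg] \subset circles t.
Proof. by apply/subsetP=> C /imsetP[e _ ->]; exact: circle_in. Qed.

Definition estate_of_signs t (sg : pred (arc D)) : estate D :=
  exist _ (t, [set circle_through t e | e in sg]) (estate_of_signs_subproof t sg).

Lemma sgn_estate_of_signs t (sg : pred (arc D)) :
    (forall e f, f \in circle_through t e -> sg f = sg e) ->
  sgn (estate_of_signs t sg) =1 sg.
Proof.
move=> inv e; apply/imsetP/idP=> [[f sf /eqP]|se]; last by exists e.
by rewrite eq_circle => /inv <-.
Qed.

Lemma sgn_minus_at s e f :
  sgn (minus_at s (circle_through s e)) f = (f \notin circle_through s e).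
Proof.
by rewrite /sgn /plus /= !inE circle_in andbT eq_circle -!mem_circle circle_sym.
Qed.

Lemma minus_minus_at s e :
  minus (minus_at s (circle_through s e)) = [set circle_through s e].
Proof.
apply/setP=> C; rewrite /minus /plus /lab /= !inE.
by case: (eqVneq C _) => [->|_]; rewrite ?circle_in //=; case: (_ \in _).
Qed.

Definition two_minus T e u : bool :=
  (u \notin circle_through (lab T) e) &&
  [forall a, sgn T a == (a \notin circle_through (lab T) e)
                        && (a \notin circle_through (lab T) u)].

Lemma two_minus_eq T e u v :
  v \in circle_through (lab T) u -> two_minus T e u = two_minus T e v.
Proof.
move=> uv; rewrite /two_minus (circle_eq uv); congr (_ && _).
by rewrite ![_ \in circle_through _ e]circle_sym (circle_eq uv).
Qed.

Lemma two_minusC T e u : two_minus T e u = two_minus T u e.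
Proof.
rewrite /two_minus circle_sym; congr (_ && _).
by apply: eq_forallb => a; rewrite andbC.
Qed.

(** The two sides [u] and [v] of the step [x] contribute independently. If the
    circle of [e] is the one that splits, both parts get the sign minus; if not,
    exactly one of the two parts does. In both cases [T] has, besides the minus
    circle through [e], one minus circle through [u] or [v]. *)
Lemma split_minus_at x T e u v :
    let s := removed (lab T) x in
    lab T x -> fused (lab T) s u v ->
  (adjacent_at x (minus_at s (circle_through s e)) T
    = two_minus T e u + two_minus T e v :> nat)%N.
Proof.
move=> s Tx F; pose t := lab T.
have uv := F.1; have vu := uv; rewrite circle_sym in vu.
set S := minus_at _ _.
have A := @split_adjacent x S T u v Tx erefl F.
have sS a : sgn S a = (a \notin circle_through s e) by exact: sgn_minus_at.
have su : (u \in circle_through s e) = (e \in circle_through t u :|: circle_through t v).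
  apply/idP/idP=> [ue|/(fused_in F)->]; last by rewrite inE mem_circle_self.
  by rewrite -(fused_u F) circle_sym.
case: (boolP (e \in circle_through t u)) => eu.
  have ce : circle_through s e = circle_through t u :|: circle_through t v.
    by rewrite (fused_in F) // in_setU eu.
  have -> : two_minus T e u = false by rewrite /two_minus circle_sym eu.
  congr nat_of_bool; apply/A/andP=> -[h1 h2].
    split; first by rewrite -(circle_eq eu).
    apply/forallP=> a; apply/eqP.
    have e1 : circle_through t e = circle_through t u by rewrite -(circle_eq eu).
    rewrite sS su in_setU eu /= in h2.
    rewrite e1 -negb_or -in_setU; case: (boolP (a \in _)) => /= Wa; last first.
      by rewrite -h1 // sS ce Wa.
    by move: Wa h2; rewrite in_setU => /orP[] /(@sgn_circle T) ->; do 2!case: (sgn T _).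
  move/forallP in h2.
  have e1 : circle_through t e = circle_through t u by rewrite -(circle_eq eu).
  split=> [a Wa|]; last first.
    rewrite sS su in_setU eu (eqP (h2 u)) (eqP (h2 v)) e1 !mem_circle_self.
    by rewrite andbF.
  by rewrite (eqP (h2 a)) sS ce Wa e1 -negb_or -in_setU Wa.
case: (boolP (e \in circle_through t v)) => ev.
  have ce : circle_through s e = circle_through t u :|: circle_through t v.
    by rewrite (fused_in F) // in_setU ev orbT.
  have -> : two_minus T e v = false by rewrite /two_minus circle_sym ev.
  have e1 : circle_through t e = circle_through t v by rewrite -(circle_eq ev).
  rewrite addn0; congr nat_of_bool; apply/A/andP=> -[h1 h2].
    split; first by rewrite e1.
    apply/forallP=> a; apply/eqP.
    rewrite sS su in_setU ev orbT /= in h2.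
    rewrite e1 andbC -negb_or -in_setU; case: (boolP (a \in _)) => /= Wa; last first.
      by rewrite -h1 // sS ce Wa.
    by move: Wa h2; rewrite in_setU => /orP[] /(@sgn_circle T) ->; do 2!case: (sgn T _).
  move/forallP in h2.
  split=> [a Wa|]; last first.
    rewrite sS su in_setU ev orbT (eqP (h2 u)) (eqP (h2 v)) e1 !mem_circle_self.
    by rewrite andbF.
  by rewrite (eqP (h2 a)) sS ce Wa e1 andbC -negb_or -in_setU Wa.
have We : e \notin circle_through t u :|: circle_through t v.
  by rewrite in_setU negb_or eu ev.
have ue : u \notin circle_through t e by rewrite circle_sym.
have ve : v \notin circle_through t e by rewrite circle_sym.
(* both at once would give [u] the sign plus and the sign minus *)
have nb : ~~ (two_minus T e u && two_minus T e v).
  apply/negP=> /andP[/andP[_ /forallP h1] /andP[_ /forallP h2]].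
  have /eqP := h1 u; rewrite (eqP (h2 u)) mem_circle_self andbF ue /=.
  by rewrite circle_sym (negbTE uv).
rewrite (sS u) su (negbTE We) /= in A.
have sSW a : sgn S a = (a \notin circle_through t e) by rewrite sS (fused_out F).
have : adjacent_at x S T = two_minus T e u || two_minus T e v.
  apply/A/orP=> [[h1 h2]|].
    have : sgn T u != sgn T v.
      by move: h2; do 2!case: (sgn T _).
    case: (boolP (sgn T u)) => Tu; case: (boolP (sgn T v)) => Tv // _.
      right; rewrite /two_minus ve; apply/forallP=> a; apply/eqP.
      case: (boolP (a \in circle_through t v)) => av.
        by rewrite (sgn_circle av) (negbTE Tv) andbF.
      case: (boolP (a \in circle_through t u)) => au.
        by rewrite (sgn_circle au) Tu circle_sym -(circle_eq au) eu.
      by rewrite -h1 ?in_setU ?(negbTE av) ?(negbTE au) // sSW andbT.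
    left; rewrite /two_minus ue; apply/forallP=> a; apply/eqP.
    case: (boolP (a \in circle_through t u)) => au.
      by rewrite (sgn_circle au) (negbTE Tu) andbF.
    case: (boolP (a \in circle_through t v)) => av.
      by rewrite (sgn_circle av) Tv circle_sym -(circle_eq av) ev.
    by rewrite -h1 ?in_setU ?(negbTE av) ?(negbTE au) // sSW andbT.
  case=> /andP[_ /forallP h].
    split=> [a|].
      by rewrite in_setU negb_or (eqP (h a)) sSW => /andP[-> _]; rewrite andbT.
    by rewrite (eqP (h u)) (eqP (h v)) ue ve uv mem_circle_self.
  split=> [a|].
    by rewrite in_setU negb_or (eqP (h a)) sSW => /andP[_ ->]; rewrite andbT.
  by rewrite (eqP (h u)) (eqP (h v)) ue ve vu mem_circle_self.
by move: nb => /[swap] ->; do 2!case: (two_minus T e _).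
Qed.

Lemma merge_minus_at x T e u v :
    let s := removed (lab T) x in
    lab T x -> fused s (lab T) u v ->
    e \in circle_through s u :|: circle_through s v ->
  adjacent_at x (minus_at s (circle_through s e)) T
    = (T == minus_at (lab T) (circle_through (lab T) u)).
Proof.
move=> s Tx F We; set S := minus_at _ _; pose t := lab T.
have sS a : sgn S a = (a \notin circle_through s e) by exact: sgn_minus_at.
have A := @merge_adjacent x S T u v Tx erefl F.
have uv := F.1; have vu := uv; rewrite circle_sym in vu.
have h0 : (sgn S u + sgn S v = 1)%N.
  by rewrite !sS; move: We; rewrite in_setU => /orP[] /circle_eq <-;
     rewrite mem_circle_self ?uv ?vu.
have out a : a \notin circle_through s u :|: circle_through s v -> sgn S a.
  move=> Wa; rewrite sS; apply: contraNN Wa => ae.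
  rewrite in_setU circle_sym [X in _ || X]circle_sym -(circle_eq ae).
  by rewrite circle_sym [X in _ || X]circle_sym -in_setU.
apply/A/eqP=> [[h1 h2]|E].
  apply: estate_eq => // a; rewrite sgn_minus_at (fused_u F).
  have Tu : sgn T u = false by move: h2; rewrite h0; case: sgn.
  case: (boolP (a \in _)) => Wa /=; last by rewrite h1 // out.
  by rewrite -(fused_u F) in Wa; rewrite (sgn_circle Wa).
have sT a : sgn T a = (a \notin circle_through t u) by rewrite E sgn_minus_at.
split=> [a Wa|]; first by rewrite out // sT (fused_u F).
by rewrite h0 sT mem_circle_self.
Qed.

End Circles.

(** * The differential of an enhanced state *)

Section Sums.
Variable D : diagram.
Implicit Types (s t : kstate D) (S T : estate D) (e f u v : arc D) (x : 'I_(ncro D)).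

Lemma removed_inj x s t : s x -> t x -> removed s x = removed t x -> s = t.
Proof.
move=> sx tx E; apply/ffunP=> y; case: (eqVneq y x) => [->|nyx]; first by rewrite sx.
by have := congr1 (fun r : kstate D => r y) E; rewrite !removedE nyx.
Qed.

Definition split_estate t u v b1 b2 (S : estate D) : estate D :=
  estate_of_signs t (fun e => if e \in circle_through t u then b1
                 else if e \in circle_through t v then b2 else sgn S e).

Lemma same_circle t u e f : f \in circle_through t e ->
  (f \in circle_through t u) = (e \in circle_through t u).
Proof. by move=> ef; rewrite ![_ \in circle_through t u]circle_sym (circle_eq ef). Qed.

Section Split.
Variables (t : kstate D) (S : estate D) (u v : arc D).
Hypothesis F : fused t (lab S) u v.

Lemma sgn_split_estate b1 b2 e : sgn (split_estate t u v b1 b2 S) e =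
  if e \in circle_through t u then b1
                 else if e \in circle_through t v then b2 else sgn S e.
Proof.
apply: sgn_estate_of_signs => {}e f ef; rewrite !(same_circle _ ef).
case: ifP => // /negbT eu; case: ifP => // /negbT ev.
rewrite /sgn !(fused_out F) ?(circle_eq ef) // in_setU negb_or ?eu //.
by rewrite !(same_circle _ ef) eu.
Qed.

Lemma split_sum (V : zmodType) (G : estate D -> V) x :
    t x -> lab S = removed t x ->
  \sum_(T | adjacent_at x S T) G T =
    if sgn S u then G (split_estate t u v true false S) + G (split_estate t u v false true S)
    else G (split_estate t u v false false S).
Proof.
move=> tx lS; have uv := F.1; have vu := uv; rewrite circle_sym in vu.
have adjE b1 b2 : adjacent_at x S (split_estate t u v b1 b2 S) = (b1 + b2 == sgn S u)%N.
  apply/(@split_adjacent _ x S _ u v)/eqP => //; rewrite !sgn_split_estate !mem_circle_self (negbTE uv).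
    by case.
  move=> E; split=> // e; rewrite in_setU negb_or sgn_split_estate.
  by move=> /andP[/negbTE-> /negbTE->].
have inj T : adjacent_at x S T ->
    exists b1 b2, T = split_estate t u v b1 b2 S /\ (b1 + b2 = sgn S u)%N.
  move=> h; exists (sgn T u), (sgn T v); have [Tx lT] := adjacent_lab h.
  have lTt : lab T = t by apply: (@removed_inj x) => //; rewrite -lT.
  have FT := F; rewrite -lTt in FT.
  have /(split_adjacent Tx lT FT)[h1 h2] := h.
  split=> //.
  apply: estate_eq => // e; rewrite sgn_split_estate -lTt.
  case: ifP => [/sgn_circle //|/negbT eu]; case: ifP => [/sgn_circle //|/negbT ev].
  by rewrite h1 // in_setU negb_or eu ev.
case: (boolP (sgn S u)) => Su; last first.
  rewrite (big_pred1 (split_estate t u v false false S)) // => T.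
  apply/idP/eqP => [h|->]; last by rewrite adjE (negbTE Su).
  by have [[] [[] [-> //]]] := inj _ h; rewrite (negbTE Su).
have neq : split_estate t u v true false S != split_estate t u v false true S.
  apply/eqP=> /(congr1 (fun T => sgn T u)); rewrite !sgn_split_estate mem_circle_self //.
rewrite (bigD1 (split_estate t u v true false S)) /= ?adjE ?Su //.
rewrite (big_pred1 (split_estate t u v false true S)) // => T.
apply/andP/eqP=> [[h n]|->]; last by split; [rewrite adjE Su | rewrite eq_sym neq].
move: n; have [[] [[] [-> //]]] := inj _ h; rewrite ?Su // ?eqxx //.
Qed.

End Split.

Section Merge.
Variables (t : kstate D) (S : estate D) (u v : arc D).
Hypothesis F : fused (lab S) t u v.

Definition merge_estate : estate D :=
  estate_of_signs t (fun e => if e \in circle_through t u then sgn S u && sgn S v else sgn S e).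

Lemma sgn_merge_estate e : sgn merge_estate e =
  if e \in circle_through t u then sgn S u && sgn S v else sgn S e.
Proof.
apply: sgn_estate_of_signs => {}e f ef; rewrite !(same_circle _ ef).
case: ifP => // /negbT eu; move: ef.
rewrite (fused_out F); first exact: sgn_circle.
by rewrite -(fused_u F).
Qed.

Lemma merge_sum (V : zmodType) (G : estate D -> V) x :
    t x -> lab S = removed t x ->
  \sum_(T | adjacent_at x S T) G T =
    if sgn S u || sgn S v then G merge_estate else 0.
Proof.
move=> tx lS.
have inj T : adjacent_at x S T -> T = merge_estate /\ (sgn S u || sgn S v).
  move=> h; have [Tx lT] := adjacent_lab h.
  have lTt : lab T = t by apply: (@removed_inj x) => //; rewrite -lT.
  have FT := F; rewrite -lTt in FT.
  have /(merge_adjacent Tx lT FT)[h1 h2] := h.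
  split; last by move: h2; do !case: sgn.
  apply: estate_eq => // e; rewrite sgn_merge_estate -lTt; case: ifP => [/sgn_circle ->|/negbT eu].
    by move: h2; do !case: sgn.
  by rewrite h1 // -(fused_u FT).
have adj : adjacent_at x S merge_estate = sgn S u || sgn S v.
  apply/idP/idP=> [/inj[]//|h].
  apply/(@merge_adjacent _ x S _ u v) => //; split=> [e eW|].
    by rewrite sgn_merge_estate (fused_u F) (negbTE eW).
  by rewrite sgn_merge_estate mem_circle_self; move: h; do !case: sgn.
case: ifP => c; last by rewrite big_pred0 // => T; apply/negP=> /inj[_]; rewrite c.
rewrite (big_pred1 merge_estate) // => T; apply/idP/eqP=> [/inj[] //|->]; by rewrite adj.
Qed.

End Merge.

Lemma minus_in S e : ~~ sgn S e -> circle_through (lab S) e \in minus S.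
Proof. by move=> h; rewrite inE circle_in andbT. Qed.

Lemma minus_gt0 S e : ~~ sgn S e -> (0 < #|minus S|)%N.
Proof. by move=> /minus_in h; rewrite (cardD1 (circle_through (lab S) e)) h. Qed.

Lemma minus_gt1 S e f : ~~ sgn S e -> ~~ sgn S f -> f \notin circle_through (lab S) e ->
  (1 < #|minus S|)%N.
Proof.
move=> /minus_in he /minus_in hf ef.
rewrite (cardsD1 (circle_through (lab S) e)) he.
rewrite (cardsD1 (circle_through (lab S) f)) in_setD1 hf.
by rewrite eq_sym eq_circle ef.
Qed.

(** Both the exponent of the sign in the differential and, on a ladder, the
    label which tells the circles apart. *)
Definition reds s (k : nat) : nat := #|[set y : 'I_(ncro D) | (y < k)%N && s y]|.

Lemma incidenceE S T :
  incidence S T = \sum_(x | adjacent_at x S T) (-1) ^+ reds (lab T) x.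
Proof.
apply: eq_bigr => x /adjacent_lab[_ ->]; congr (_ ^+ _).
apply: eq_card => y; rewrite !inE removedE; case: ltnP => //= yx.
by rewrite neq_ltn yx.
Qed.

Lemma dif_gen S T : dif (gen S) T = incidence S T.
Proof.
rewrite ffunE (bigD1 S) //= ffunE eqxx mul1r big1 ?addr0 // => S' /negbTE n.
by rewrite ffunE n mul0r.
Qed.

Lemma reds0 s : reds s 0 = 0%N.
Proof. by rewrite /reds; apply/eqP; rewrite cards_eq0; apply/eqP/setP=> y; rewrite !inE. Qed.

Lemma redsS s x : reds s x.+1 = (reds s x + s x)%N.
Proof.
rewrite /reds (cardsD1 x) inE ltnSn /= addnC; congr (_ + _)%N.
by apply: eq_card => y; rewrite !inE ltnS -val_eqE /=; case: ltngtP.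
Qed.

Lemma reds_le s i j : (i <= j)%N -> (reds s i <= reds s j)%N.
Proof.
move=> ij; apply/subset_leq_card/subsetP=> y; rewrite !inE => /andP[yi ->].
by rewrite (leq_trans yi).
Qed.

Lemma reds_removed s x k : s x ->
  reds s k = (reds (removed s x) k + (x < k))%N.
Proof.
move=> sx; rewrite /reds (cardsD1 x) inE sx andbT addnC; congr (_ + _)%N.
apply: eq_card => y; rewrite !inE removedE; by do !case: (_ == _); rewrite ?andbF.
Qed.

Lemma reds_const s i j : (i <= j)%N -> (forall x : 'I_(ncro D), (i <= x < j)%N -> ~~ s x) ->
  reds s i = reds s j.
Proof.
move=> ij H; apply: eq_card => x; rewrite !inE.
case: (ltnP x i) => xi; first by rewrite (leq_trans xi).
by case: ltnP => //= xj; apply/esym/negbTE/H; rewrite xi.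
Qed.

Lemma ideg_reds S : ideg S = (reds (lab S) (ncro D))%:Z.
Proof. by congr (_%:Z); apply: eq_card => x; rewrite !inE ltn_ord. Qed.

Lemma genE S T : gen S T = (T == S)%:R.
Proof. by rewrite ffunE. Qed.

Lemma difD (c c' : chain D) : dif (c + c') = dif c + dif c'.
Proof. exact: raddfD. Qed.

(** The source of an incidence with target [T] is determined by the crossing, so
    a sum over states becomes a sum over the red crossings of [T]. *)
Lemma sum_incidence (P : pred (kstate D)) (e : arc D) T :
  \sum_(s | P s) incidence (minus_at s (circle_through s e)) T =
  \sum_(x | lab T x && P (removed (lab T) x)) (-1) ^+ reds (lab T) x *+
     adjacent_at x (minus_at (removed (lab T) x) (circle_through (removed (lab T) x) e)) T.
Proof.
under eq_bigr do rewrite incidenceE big_mkcond /=.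
rewrite exchange_big /= [RHS]big_mkcond; apply: eq_bigr => x _.
case: ifP => [/andP[Tx Ps]|n].
  rewrite (bigD1 (removed (lab T) x)) //= big1 ?addr0.
    by rewrite mulrb.
  move=> s /andP[_ ns]; case: ifP => // /adjacent_lab[_ /= E].
  by rewrite -E eqxx in ns.
rewrite big1 // => s Ps; case: ifP => // /adjacent_lab[Tx /= E].
by rewrite Tx -E Ps in n.
Qed.

End Sums.

(** * Walking along a ladder *)

Section Ladder.
Variables (A : finType) (E : rel A).
Hypotheses (Er : reflexive E) (Es : symmetric E) (Et : transitive E).
Variables (p q : nat -> A) (R : nat -> nat).

(** [p] and [q] are the rails, [R] counts the red steps: a blue step prolongs
    both rails, a red one joins them on each of its sides. *)
Definition ladder_step k :=
  (R k.+1 = R k /\ E (p k) (p k.+1) /\ E (q k) (q k.+1)) \/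
  (R k.+1 = (R k).+1 /\ E (p k) (q k) /\ E (p k.+1) (q k.+1)).

Lemma segment i j : (i <= j)%N -> (forall k, (i <= k < j)%N -> ladder_step k) ->
  (R i = R j /\ E (p i) (p j) /\ E (q i) (q j)) \/
  ((R i < R j)%N /\ E (p i) (q i) /\ E (p j) (q j)).
Proof.
elim: j => [|j IH] ij H.
  by move: ij; rewrite leqn0 => /eqP->; left; rewrite !Er.
move: ij; rewrite leq_eqVlt => /predU1P[->|ij]; first by left; rewrite !Er.
have {}IH := IH ij (fun k (h : (i <= k < j)%N) => H k ltac:(lia)).
have [[-> [pp qq]]|[-> [pq pq']]] := H j ltac:(lia).
  case: IH => -[h [h1 h2]]; [left|right]; split=> //; split=> //.
  - exact: Et pp.
  - exact: Et qq.
  - by apply: Et (Et h2 qq); rewrite Es.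
right; case: IH => -[h [h1 h2]]; (split; [lia | split=> //]).
by apply: Et h1 (Et pq _); rewrite Es.
Qed.

(* The step [x] is left out, and the ladder is closed up from outside: either
   each rail has its two ends joined, or the two rails are joined at each end. *)
Variables (h x : nat).
Hypothesis xh : (x < h)%N.
Hypothesis steps : forall k, (k < h)%N -> k != x -> ladder_step k.

Let before : (R 0 = R x /\ E (p 0) (p x) /\ E (q 0) (q x)) \/
  ((R 0 < R x)%N /\ E (p 0) (q 0) /\ E (p x) (q x)).
Proof. by apply: segment => // k kx; apply: steps; lia. Qed.

Let after : (R x.+1 = R h /\ E (p x.+1) (p h) /\ E (q x.+1) (q h)) \/
  ((R x.+1 < R h)%N /\ E (p x.+1) (q x.+1) /\ E (p h) (q h)).
Proof. by apply: segment => // k kx; apply: steps; lia. Qed.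

(** Going away from [x] along a rail one meets a red step, which leads back on
    the other rail; if there is none on that side, one leaves the ladder at its
    end, comes back at the other end and meets one there. *)
Lemma split_rails : E (p 0) (p h) -> E (q 0) (q h) ->
  (R 0 < R x)%N || (R x.+1 < R h)%N ->
  E (p x) (q x) /\ E (p x.+1) (q x.+1).
Proof.
move=> pp qq; case: before => -[b [b1 b2]]; case: after => -[a [a1 a2]] reds.
- by rewrite b a !ltnn in reds.
- split; last exact: a1.
  apply: Et (_ : E (p x) (p h)) _; first by apply: Et pp; rewrite Es.
  by apply: Et a2 _; apply: Et b2; rewrite Es.
- split; first exact: b2.
  apply: Et a1 _; rewrite Es; apply: Et a2 _.
  by rewrite Es; apply: Et qq; apply: Et b1; rewrite Es.
- by split; [exact: b2 | exact: a1].
Qed.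

Lemma split_caps : E (p 0) (q 0) -> E (p h) (q h) ->
  E (p x) (q x) /\ E (p x.+1) (q x.+1).
Proof.
move=> c0 ch; split.
  case: before => -[_ [b1 b2]] //.
  by apply: Et b2; apply: Et c0; rewrite Es.
case: after => -[_ [b1 b2]] //.
by apply: Et b1 _; apply: Et ch _; rewrite Es.
Qed.

Lemma merge_rails : E (p 0) (p h) -> E (q 0) (q h) -> R 0 = R x -> R x.+1 = R h ->
  E (p x) (p x.+1) /\ E (q x.+1) (q x).
Proof.
move=> pp qq R1 R2.
case: before => -[b [b1 b2]]; last by rewrite R1 ltnn in b.
case: after => -[a [a1 a2]]; last by rewrite R2 ltnn in a.
split.
  by apply: Et (_ : E (p x) (p 0)) _; rewrite Es //; apply: Et a1 _; rewrite Es.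
by apply: Et a2 _; rewrite Es; apply: Et qq; rewrite Es.
Qed.

End Ladder.

(** * The arcs and the crossings of the monocircular diagram *)

Section Pretzel.
Variables h1 h2 : nat.
Hypotheses (h1_gt0 : (0 < h1)%N) (h2_gt0 : (0 < h2)%N).
Local Notation D := (mono h1 h2).
Local Notation N := (h1 + h2)%N.
Local Notation top := (top h1 h2).
Local Notation bot := (bot h1 h2).
Local Notation lft := (lft h1 h2).
Local Notation rgt := (rgt h1 h2).
Implicit Types (s t : kstate D) (S T : estate D).

Let n_gt1 : (1 < 2 * N)%N. Proof. lia. Qed.

Lemma natZ k : (k < 2 * N)%N -> nat_of_ord (k%:R : 'Z_(2 * N)) = k.
Proof. by move=> h; rewrite val_Zp_nat // modn_small. Qed.

Lemma oppZ k : (k <= 2 * N)%N -> - (k%:R : 'Z_(2 * N)) = (2 * N - k)%:R.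
Proof. by move=> h; rewrite natrB // pchar_Zp // sub0r. Qed.

Lemma val_top k : (k <= h1)%N -> nat_of_ord (top k) = k.
Proof. by move=> h; rewrite natZ //; lia. Qed.
Lemma val_lft m : (m <= h2)%N -> nat_of_ord (lft m) = (h1 + m)%N.
Proof. by move=> h; rewrite natZ //; lia. Qed.
Lemma val_bot k : (k <= h1)%N -> nat_of_ord (bot k) = (h1 + N - k)%N.
Proof. move=> h; rewrite /Defs.bot oppZ ?natZ; lia. Qed.
Lemma val_rgt m : (0 < m <= h2)%N -> nat_of_ord (rgt m) = (2 * N - m)%N.
Proof. move=> h; rewrite /Defs.rgt oppZ ?natZ; lia. Qed.

Lemma lft0 : lft 0 = top h1.
Proof. by rewrite /Defs.lft addn0. Qed.
Lemma rgt0 : rgt 0 = top 0.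
Proof. by rewrite /Defs.rgt oppr0. Qed.
Lemma lft_h2 : lft h2 = bot h1.
Proof. by apply: ord_inj; rewrite val_bot // val_lft //; lia. Qed.
Lemma rgt_h2 : rgt h2 = bot 0.
Proof. by apply: ord_inj; rewrite val_bot // val_rgt //; lia. Qed.

(** The two ladders share only their corners, so that functions on the four rails
    which agree there define a function on the arcs. *)
Lemma glue (T : Type) (ft fb fl fr : nat -> T) :
    ft h1 = fl 0 -> fl h2 = fb h1 -> fb 0 = fr h2 -> fr 0 = ft 0 ->
  exists psi : arc D -> T,
    (forall k, (k <= h1)%N -> psi (top k) = ft k /\ psi (bot k) = fb k) /\
    (forall m, (m <= h2)%N -> psi (lft m) = fl m /\ psi (rgt m) = fr m).
Proof.
move=> e1 e2 e3 e4.
pose psi v := if (v <= h1)%N then ft v else if (v <= N)%N then fl (v - h1)%N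
  else if (v <= h1 + N)%N then fb (h1 + N - v)%N else fr (2 * N - v)%N.
exists (fun a : 'Z_(2 * N) => psi (nat_of_ord a)).
split=> k kh; split; cbv beta; rewrite /psi.
- by rewrite val_top // kh.
- rewrite val_bot // ifF; last lia.
  case: leqP => c; last by rewrite ifT; last lia; congr fb; lia.
  have ->: k = h1 by lia.
  by rewrite -e2; congr fl; lia.
- rewrite val_lft //; case: leqP => c; first by (have ->: k = 0%N by lia); rewrite addn0.
  by rewrite ifT; [congr fl; lia | lia].
- case: (posnP k) => [->|k_gt0]; first by rewrite rgt0 val_top.
  rewrite val_rgt ?k_gt0 // ifF; last lia; rewrite ifF; last lia.
  case: leqP => c; last by congr fr; lia.
  have ->: k = h2 by lia.
  by rewrite -e3; congr fb; lia.
Qed.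

Lemma arcP (a : arc D) :
  (exists2 k, (k <= h1)%N & a = top k \/ a = bot k) \/
  (exists2 m, (m <= h2)%N & a = lft m \/ a = rgt m).
Proof.
have av : (nat_of_ord (a : 'Z_(2 * N)) < 2 * N)%N.
  by have := ltn_ord (a : 'Z_(2 * N)); rewrite [X in (_ < X)%N]Zp_cast.
pose v := nat_of_ord (a : 'Z_(2 * N)).
have aE b : v = nat_of_ord (b : 'Z_(2 * N)) -> a = b by exact: val_inj.
case: (leqP v h1) => c1; first by left; exists v => //; left; apply: aE; rewrite val_top.
case: (leqP v N) => c2.
  by right; exists (v - h1)%N; [lia | left; apply: aE; rewrite val_lft; lia].
case: (leqP v (h1 + N)) => c3.
  by left; exists (h1 + N - v)%N; [lia | right; apply: aE; rewrite val_bot; lia].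
by right; exists (2 * N - v)%N; [lia | right; apply: aE; rewrite val_rgt; lia].
Qed.

Lemma corners_l (k : 'I_h1) :
  @corners D (lshift h2 k) = (top k.+1, top k, bot k, bot k.+1).
Proof. by rewrite /= /mono_corners (unsplitK (inl k)). Qed.

Lemma corners_r (m : 'I_h2) :
  @corners D (rshift h1 m) = (lft m, lft m.+1, rgt m.+1, rgt m).
Proof. by rewrite /= /mono_corners (unsplitK (inr m)). Qed.

Section Steps.
Variables (E : rel (arc D)) (t : kstate D).
Hypothesis Es : symmetric E.

Lemma edges_step_l (k : 'I_h1) :
    (forall a b, (a, b) \in smoothing t (lshift h2 k) -> E a b) ->
  ladder_step E top bot (reds t) k.
Proof.
rewrite /smoothing corners_l /ladder_step (redsS t (lshift h2 k)).
case: (t _) => /= H; [right|left]; rewrite ?addn0 ?addn1; split=> //; split.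
- by rewrite H // !inE eqxx orbT.
- by rewrite H // !inE eqxx.
- by rewrite Es H // !inE eqxx.
- by rewrite H // !inE eqxx orbT.
Qed.

Lemma edges_step_r (m : 'I_h2) :
    (forall a b, (a, b) \in smoothing t (rshift h1 m) -> E a b) ->
  ladder_step E lft rgt (fun k => reds t (h1 + k)) m.
Proof.
rewrite /smoothing corners_r /ladder_step addnS (redsS t (rshift h1 m)).
case: (t _) => /= H; [right|left]; rewrite ?addn0 ?addn1; split=> //; split.
- by rewrite H // !inE eqxx.
- by rewrite H // !inE eqxx orbT.
- by rewrite H // !inE eqxx.
- by rewrite Es H // !inE eqxx orbT.
Qed.

End Steps.

Lemma away_step_l t (x : 'I_(ncro D)) k : (k < h1)%N -> k != x :> nat ->
  ladder_step (connect (away t x)) top bot (reds t) k.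
Proof.
move=> kh nkx; apply: (@edges_step_l _ t (@away_connect_sym _ _ _) (Ordinal kh)) => a b.
by apply: away_edge.
Qed.

Lemma away_step_r t (x : 'I_(ncro D)) m : (m < h2)%N -> (h1 + m)%N != x :> nat ->
  ladder_step (connect (away t x)) lft rgt (fun k => reds t (h1 + k)) m.
Proof.
move=> kh nkx; apply: (@edges_step_r _ t (@away_connect_sym _ _ _) (Ordinal kh)) => a b.
by apply: away_edge.
Qed.

Lemma joined_step_l t k : (k < h1)%N ->
  ladder_step (connect (joined t)) top bot (reds t) k.
Proof.
move=> kh; apply: (@edges_step_l _ t (@joined_connect_sym _ _) (Ordinal kh)) => a b.
exact: joined_edge.
Qed.

Lemma joined_step_r t m : (m < h2)%N ->
  ladder_step (connect (joined t)) lft rgt (fun k => reds t (h1 + k)) m.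
Proof.
move=> kh; apply: (@edges_step_r _ t (@joined_connect_sym _ _) (Ordinal kh)) => a b.
exact: joined_edge.
Qed.

(** This is how circles are shown to be distinct. *)
Lemma invariant_circle (T : eqType) (psi : arc D -> T) t :
    (forall x a b, (a, b) \in smoothing t x -> psi a = psi b) ->
  forall a b, b \in circle_through t a -> psi a = psi b.
Proof.
move=> H a b; rewrite mem_circle => ab; apply/eqP.
apply: (@connect_least _ _ (fun a b => psi a == psi b) _ _ _ _ _ ab) => //.
  by move=> c1 c2 c3 /eqP-> .
by move=> c d /existsP[x /orP[] /H ->].
Qed.

Lemma glue_invariant t (T : eqType) (ft fb fl fr : nat -> T) :
    ft h1 = fl 0 -> fl h2 = fb h1 -> fb 0 = fr h2 -> fr 0 = ft 0 ->
    (forall k : 'I_h1, if t (lshift h2 k) then ft k = fb k /\ ft k.+1 = fb k.+1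
                       else ft k = ft k.+1 /\ fb k = fb k.+1) ->
    (forall m : 'I_h2, if t (rshift h1 m) then fl m = fr m /\ fl m.+1 = fr m.+1
                       else fl m = fl m.+1 /\ fr m = fr m.+1) ->
  exists psi : arc D -> T,
   [/\ forall k, (k <= h1)%N -> psi (top k) = ft k /\ psi (bot k) = fb k,
       forall m, (m <= h2)%N -> psi (lft m) = fl m /\ psi (rgt m) = fr m
     & forall a b, b \in circle_through t a -> psi a = psi b].
Proof.
move=> e1 e2 e3 e4 Hl Hr.
have [psi [P1 P2]] := glue e1 e2 e3 e4; exists psi; split=> //.
apply: invariant_circle => x a b.
case: (split_ordP x) => k ->.
  rewrite /smoothing corners_l; have := Hl k.
  have [E1 E2] := P1 k (ltnW (ltn_ord k)); have [E3 E4] := P1 k.+1 (ltn_ord k).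
  by case: (t _) => -[E5 E6]; rewrite !inE !xpair_eqE => /orP[] /andP[/eqP-> /eqP->]; congruence.
rewrite /smoothing corners_r; have := Hr k.
have [E1 E2] := P2 k (ltnW (ltn_ord k)); have [E3 E4] := P2 k.+1 (ltn_ord k).
by case: (t _) => -[E5 E6]; rewrite !inE !xpair_eqE => /orP[] /andP[/eqP-> /eqP->]; congruence.
Qed.

End Pretzel.

(** * Splittings and mergings in the monocircular diagram *)

Section Fuse.
Variables h1 h2 : nat.
Hypotheses (h1_gt0 : (0 < h1)%N) (h2_gt0 : (0 < h2)%N).
Local Notation D := (mono h1 h2).
Local Notation N := (h1 + h2)%N.
Local Notation top := (top h1 h2).
Local Notation bot := (bot h1 h2).
Local Notation lft := (lft h1 h2).
Local Notation rgt := (rgt h1 h2).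
(* The arcs of [D] are elements of ['Z_(2 * N)]; the notation makes sure that
   membership is inferred for the type [arc D]. *)
Local Notation "a \on C" := (@in_mem (arc D) a (mem C)) (at level 70).
Implicit Types (s t : kstate D) (S T : estate D).

Lemma no_reds_l t i j : (i <= j <= h1)%N -> reds t i = reds t j ->
  top j \on circle_through t (top i) /\ bot j \on circle_through t (bot i).
Proof.
case/andP=> ij jh E; rewrite !mem_circle.
case: (@segment _ (connect (joined t)) (@connect0 _ _) (@joined_connect_sym _ _)
  (@connect_trans _ _) top bot (reds t) i j ij) => [k kij|[_ []] //|[]].
  by apply: joined_step_l; lia.
by rewrite E ltnn.
Qed.

Lemma no_reds_r t i j : (i <= j <= h2)%N -> reds t (h1 + i) = reds t (h1 + j) ->
  lft j \on circle_through t (lft i) /\ rgt j \on circle_through t (rgt i).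
Proof.
case/andP=> ij jh E; rewrite !mem_circle.
case: (@segment _ (connect (joined t)) (@connect0 _ _) (@joined_connect_sym _ _)
  (@connect_trans _ _) lft rgt (fun k => reds t (h1 + k)) i j ij) => [k kij|[_ []] //|[]].
  by apply: joined_step_r; lia.
by rewrite E ltnn.
Qed.

(** Any red step of a ladder joins its two corners at each end, and the corners
    of the two ladders coincide: this is the outer circle. *)
Lemma corners_circle t : (0 < reds t h1)%N -> (reds t h1 < reds t N)%N ->
  [/\ top h1 \on circle_through t (top 0), bot 0 \on circle_through t (top 0)
    & bot h1 \on circle_through t (top 0)].
Proof.
move=> r1 r2; rewrite !mem_circle.
have sg1 := @segment _ (connect (joined t)) (@connect0 _ _) (@joined_connect_sym _ _)
  (@connect_trans _ _) top bot (reds t) 0 h1 (leq0n _).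
have sg2 := @segment _ (connect (joined t)) (@connect0 _ _) (@joined_connect_sym _ _)
  (@connect_trans _ _) lft rgt (fun k => reds t (h1 + k)) 0 h2 (leq0n _).
case: sg1 => [k kh|[E]|[_ [E1 E2]]]; first by apply: joined_step_l; lia.
  by rewrite -E reds0 in r1.
case: sg2 => [k kh|[E]|[_ []]]; first by apply: joined_step_r; lia.
  by rewrite addn0 in E; rewrite E ltnn in r2.
rewrite lft0 rgt0 // lft_h2 // rgt_h2 // => E3 E4; split=> //.
  by rewrite joined_connect_sym.
by apply: connect_trans E1 _; rewrite joined_connect_sym.
Qed.

(** The two sides of the step differ by one in the number of preceding red steps.
    This number is read modulo the number of red steps of the ladder, because the
    outer circle contains its two ends. *)
Lemma split_fused_l t (k : 'I_h1) : let x := lshift h2 k : 'I_(ncro D) in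
    t x -> (1 < reds t h1)%N -> (reds t h1 < reds t N)%N ->
  fused t (removed t x) (top k) (top k.+1).
Proof.
move=> x tx r1 r2.
have RS : reds t k.+1 = (reds t k).+1 by rewrite (redsS t x) tx addn1.
have sg2 := @segment _ (connect (away t x)) (@connect0 _ _) (@away_connect_sym _ _ _)
  (@connect_trans _ _) lft rgt (fun k => reds t (h1 + k)) 0 h2 (leq0n _).
case: sg2 => [m mh|[E]|[_ []]].
- by apply: away_step_r => //=; have := ltn_ord k; lia.
- by rewrite addn0 in E; rewrite E ltnn in r2.
rewrite lft0 rgt0 // lft_h2 // rgt_h2 // => E3 E4.
have [||||E1 E2] := @split_rails _ _ (@connect0 _ _) (@away_connect_sym _ t x)
  (@connect_trans _ _) top bot (reds t) h1 k (ltn_ord k).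
- by move=> i ih nik; apply: away_step_l.
- by rewrite away_connect_sym.
- by rewrite away_connect_sym.
- by rewrite reds0 RS; lia.
apply: fusedC; apply: (split_fused (corners_l h2 k) tx E2 E1).
have [||||||psi [P1 _ inv]] := @glue_invariant _ _ h1_gt0 h2_gt0 t nat
  (fun k => reds t k %% reds t h1)%N (fun k => reds t k %% reds t h1)%N
  (fun=> 0%N) (fun=> 0%N); rewrite ?modnn ?reds0 ?mod0n //.
- by move=> i; case: ifP => // ti; rewrite (redsS t (lshift h2 i)) ti addn0.
- by move=> i; case: ifP.
apply/negP=> /inv; have [-> _] := P1 k.+1 (ltn_ord k).
have [-> _] := P1 k (ltnW (ltn_ord k)); rewrite RS => /eqP.
by rewrite -[X in _ == (X %% _)%N]addn0 -addn1 eqn_modDl modn_small // mod0n.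
Qed.

(** When the first ladder has no red step, nothing joins the two ends of the
    second one, and the number of preceding red steps is itself an invariant. *)
Lemma invariant_empty_l t : reds t h1 = 0%N -> exists psi : arc D -> nat,
   [/\ forall k, (k <= h1)%N -> psi (top k) = 0%N /\ psi (bot k) = reds t N,
       forall m, (m <= h2)%N -> psi (lft m) = reds t (h1 + m)
     & forall a b, b \on circle_through t a -> psi a = psi b].
Proof.
move=> r0.
have [||||||psi [P1 P2 inv]] := @glue_invariant _ _ h1_gt0 h2_gt0 t nat
  (fun=> 0%N) (fun=> reds t N) (fun m => reds t (h1 + m)) (fun m => reds t (h1 + m));
  rewrite ?addn0 //.
- move=> k; case: ifP => // tk; have := @reds_le _ t k.+1 h1 (ltn_ord k).
  by rewrite (redsS t (lshift h2 k)) tk; lia.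
- by move=> m; case: ifP => // tm; rewrite addnS (redsS t (rshift h1 m)) tm addn0.
by exists psi; split=> // m mh; have [] := P2 m mh.
Qed.

Lemma split_fused_r t (m : 'I_h2) : let x := rshift h1 m : 'I_(ncro D) in
    t x -> (0 < reds t h1)%N && ((reds t h1).+1 < reds t N)%N || (reds t h1 == 0)%N ->
  fused t (removed t x) (lft m) (lft m.+1).
Proof.
move=> x tx r.
have RS : reds t (h1 + m).+1 = (reds t (h1 + m)).+1 by rewrite (redsS t x) tx addn1.
have mon := @reds_le _ t.
have mh := ltn_ord m.
have sg1 := @segment _ (connect (away t x)) (@connect0 _ _) (@away_connect_sym _ _ _)
  (@connect_trans _ _) top bot (reds t) 0 h1 (leq0n _).
have [E1 E2] : connect (away t x) (lft m) (rgt m) /\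
               connect (away t x) (lft m.+1) (rgt m.+1).
  have st i : (i < h2)%N -> i != m -> ladder_step (connect (away t x)) lft rgt (fun k => reds t (h1 + k)) i.
    by move=> ih nim; apply: away_step_r => //=; rewrite eqn_add2l.
  case: sg1 => [k kh|[E [E1 E2]]|[E [E1 E2]]].
  - by apply: away_step_l => //=; lia.
  - apply: (@split_caps _ _ (@connect0 _ _) (@away_connect_sym _ t x)
      (@connect_trans _ _) lft rgt (fun k => reds t (h1 + k)) h2 m mh st).
    + by rewrite lft0 rgt0 // away_connect_sym.
    + by rewrite lft_h2 // rgt_h2 // away_connect_sym.
  apply: (@split_rails _ _ (@connect0 _ _) (@away_connect_sym _ t x)
      (@connect_trans _ _) lft rgt (fun k => reds t (h1 + k)) h2 m mh st).
  + by rewrite lft0 lft_h2.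
  + by rewrite rgt0 // rgt_h2.
  + rewrite addn0 addnS RS; move: r; rewrite reds0 in E.
    have := mon h1 (h1 + m)%N (leq_addr _ _); lia.
apply: (split_fused (corners_r h1 m) tx E1 E2).
case/orP: r => [/andP[r1 r2]|/eqP r0].
  have [||||||psi [_ P2 inv]] := @glue_invariant _ _ h1_gt0 h2_gt0 t nat
    (fun=> 0%N) (fun=> 0%N)
    (fun k => (reds t (h1 + k) - reds t h1) %% (reds t N - reds t h1))%N
    (fun k => (reds t (h1 + k) - reds t h1) %% (reds t N - reds t h1))%N;
    rewrite ?addn0 ?subnn ?modnn ?mod0n //.
  - by move=> i; case: ifP.
  - by move=> i; case: ifP => // ti; rewrite addnS (redsS t (rshift h1 i)) ti addn0.
  apply/negP=> /inv; have [-> _] := P2 m.+1 mh.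
  have [-> _] := P2 m (ltnW mh); rewrite addnS RS => /eqP.
  rewrite subSn ?mon ?leq_addr // -[X in (X %% _)%N == _]addn0 -addn1 eqn_modDl.
  by rewrite mod0n modn_small //; lia.
have [psi [_ P inv]] := invariant_empty_l r0.
apply/negP=> /inv; rewrite !P //; last exact: ltnW.
by rewrite addnS RS; lia.
Qed.

(** Before the only red step of the first ladder is added, its two rails are on
    the circles at the two ends of the second ladder. *)
Lemma merge_fused_l t (k : 'I_h1) : let x := lshift h2 k : 'I_(ncro D) in
    t x -> reds t h1 = 1%N -> (1 < reds t N)%N ->
  fused (removed t x) t (lft 0) (lft h2).
Proof.
move=> x tx r1 r2.
have RS : reds t k.+1 = (reds t k).+1 by rewrite (redsS t x) tx addn1.
have mon := @reds_le _ t.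
have kh := ltn_ord k.
have s0 : reds (removed t x) h1 = 0%N.
  by have := @reds_removed _ t x h1 tx; rewrite r1 /= kh; lia.
have sN : (0 < reds (removed t x) N)%N.
  by have := @reds_removed _ t x N tx; rewrite /= ltn_addr //; lia.
have sg2 := @segment _ (connect (away t x)) (@connect0 _ _) (@away_connect_sym _ _ _)
  (@connect_trans _ _) lft rgt (fun k => reds t (h1 + k)) 0 h2 (leq0n _).
case: sg2 => [m mh|[E]|[_ []]].
- by apply: away_step_r => //=; lia.
- by rewrite addn0 in E; lia.
rewrite lft0 rgt0 // lft_h2 // rgt_h2 // => E3 E4.
have [|||||E1 E2] := @merge_rails _ (connect (away t x)) (@connect0 _ _)
  (@away_connect_sym _ _ _) (@connect_trans _ _) top bot (reds t) h1 k kh.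
- by move=> i ih nik; apply: away_step_l.
- by rewrite away_connect_sym.
- by rewrite away_connect_sym.
- by have := mon k.+1 h1 kh; rewrite reds0; lia.
- by have := mon k.+1 h1 kh; lia.
have nc i : (i <= h1)%N -> reds (removed t x) i = 0%N.
  by move=> ih; have := @reds_le _ (removed t x) i h1 ih; lia.
apply: (@fused_repr D _ _ (top k.+1) (bot k)).
- apply: merge_fused (corners_l h2 k) tx _ _ _ => //; first by rewrite away_connect_sym.
    by rewrite away_connect_sym.
  have [psi [P1 _ inv]] := invariant_empty_l s0.
  apply/negP=> /inv; have [_ ->] := P1 k (ltnW kh); have [-> _] := P1 k.+1 kh; lia.
- by case: (@no_reds_l (removed t x) k.+1 h1); rewrite ?kh ?nc ?leqnn.
- by case: (@no_reds_l (removed t x) k h1); rewrite ?(ltnW kh) ?nc ?leqnn // ltnW.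
Qed.

End Fuse.

(** * The chains with one minus circle *)

Section Chains.
Variables h1 h2 : nat.
Local Notation D := (mono h1 h2).
Local Notation N := (h1 + h2)%N.
Local Notation top := (top h1 h2).
Local Notation bot := (bot h1 h2).
Local Notation lft := (lft h1 h2).
Local Notation rgt := (rgt h1 h2).
Local Notation "a \on C" := (@in_mem (arc D) a (mem C)) (at level 70).
Implicit Types (s t : kstate D) (S T : estate D).

(* [reds s h1] and [reds s N - reds s h1] are the numbers of red steps of the
   two ladders. *)
Definition ranks m1 m2 s := (reds s h1 == m1) && (reds s N == m1 + m2)%N.

Definition minus_sum m1 m2 (e : arc D) : chain D :=
  \sum_(s | ranks m1 m2 s) gen (minus_at s (circle_through s e)).

Lemma minus_sumE m1 m2 e T : minus_sum m1 m2 e T =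
  (ranks m1 m2 (lab T) && (T == minus_at (lab T) (circle_through (lab T) e)))%:R.
Proof.
rewrite sum_ffunE.
under eq_bigr do rewrite genE.
case: (boolP (ranks _ _ _)) => [P|nP]; rewrite ?andTb ?andFb.
  rewrite (bigD1 (lab T) P) big1; first exact: addr0.
  move=> s /andP[_ ns].
  by case: eqP => // Ts; rewrite Ts eqxx in ns.
rewrite big1 // => s Ps; case: eqP => // Ts.
by move: nP; rewrite Ts Ps.
Qed.

Lemma minus_sum_chains m1 m2 e i c :
    (forall s, ranks m1 m2 s -> #|circles s| = c) -> i = (m1 + m2)%N ->
  minus_sum m1 m2 e \in chains i%:Z (i%:Z + c%:Z - 2).
Proof.
move=> H ->; apply/chainsP=> T nT; rewrite minus_sumE.
case: (boolP (ranks _ _ _)) => //= P; case: eqP => //= TE; case/negP: nT.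
have mT : #|minus T| = 1%N by rewrite TE minus_minus_at cards1.
rewrite /jdeg theta_minus (H _ P) mT ideg_reds.
have /andP[_ /eqP ->] := P; rewrite eqxx /=; apply/eqP; lia.
Qed.

(** In the target, the added step is one of those of the first ladder, which then
    has [m1.+1] red steps, or one of those of the second ladder. *)
Lemma dif_minus_sum m1 m2 e T : let t := lab T in
  let term (x : 'I_(ncro D)) : int := (-1) ^+ reds t x *+
     adjacent_at x (minus_at (removed t x) (circle_through (removed t x) e)) T in
  dif (minus_sum m1 m2 e) T =
  \sum_(k : 'I_h1 | t (lshift h2 k) && ranks m1.+1 m2 t) term (lshift h2 k)
  + \sum_(m : 'I_h2 | t (rshift h1 m) && ranks m1 m2.+1 t) term (rshift h1 m) :> int.
Proof.
move=> t term; rewrite raddf_sum sum_ffunE.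
under eq_bigr do rewrite dif_gen.
rewrite sum_incidence -/t (@big_split_ord _ _ _ h1 h2) /=; congr (_ + _).
  apply: eq_bigl => k; case: (boolP (t _)) => //= tk.
  rewrite /ranks; have := @reds_removed _ t _ h1 tk; have := @reds_removed _ t _ N tk.
  rewrite /= ltn_ord ltn_addr // => -> ->; lia.
apply: eq_bigl => k; case: (boolP (t _)) => //= tk.
rewrite /ranks; have := @reds_removed _ t _ h1 tk; have := @reds_removed _ t _ N tk.
rewrite /= ltn_add2l ltn_ord [(h1 + k < h1)%N]ltnNge leq_addr /= => -> ->; lia.
Qed.

Lemma ex_red_l t : (0 < reds t h1)%N -> exists k : 'I_h1, t (lshift h2 k).
Proof.
move/card_gt0P=> [x]; rewrite inE; case: (split_ordP x) => k -> /andP[kh tk]; first by exists k.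
by move: kh => /=; lia.
Qed.

Lemma ex_red_r t : reds t h1 = 0%N -> (0 < reds t N)%N -> exists m : 'I_h2, t (rshift h1 m).
Proof.
move=> r0 /card_gt0P[x]; rewrite inE; case: (split_ordP x) => k -> /andP[kh tk]; last by exists k.
by move/eqP: r0; rewrite cards_eq0 => /eqP/setP/(_ (lshift h2 k)); rewrite !inE /= ltn_ord tk.
Qed.

Hypotheses (h1_gt0 : (0 < h1)%N) (h2_gt0 : (0 < h2)%N).

Lemma card_circles_A t : reds t N = 0%N -> #|circles t| = 1%N.
Proof.
move=> r0; have r k : (k <= N)%N -> reds t k = 0%N.
  by move=> kN; have := @reds_le _ t k N kN; lia.
have l k : (k <= h1)%N -> top k \on circle_through t (top 0) /\ bot k \on circle_through t (bot 0).
  by move=> kh; apply: no_reds_l => //; rewrite !r //; lia.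
have r' k : (k <= h2)%N -> lft k \on circle_through t (lft 0) /\ rgt k \on circle_through t (rgt 0).
  by move=> kh; apply: no_reds_r => //; rewrite !r //; lia.
have c0 : bot 0 \on circle_through t (top 0).
  by have [_] := r' h2 (leqnn _); rewrite rgt_h2 // rgt0.
suff -> : circles t = [set circle_through t (top 0)] by rewrite cards1.
apply/setP=> C; rewrite inE; apply/imsetP/eqP=> [[a _ ->]|->]; last by exists (top 0).
apply/eqP; rewrite eq_circle circle_sym.
have [[k kh [->|->]]|[m mh [->|->]]] := arcP h1_gt0 h2_gt0 a.
- by have [] := l k kh.
- by rewrite (circle_eq c0); have [] := l k kh.
- by have [] := r' m mh; rewrite lft0 -(circle_eq (l h1 (leqnn _)).1).
- by have [] := r' m mh; rewrite rgt0.
Qed.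

Lemma card_circles_empty_l t : reds t h1 = 0%N -> #|circles t| = (reds t N).+1.
Proof.
have [n] := ubnP (reds t N); elim: n t => // n IH t tn r0.
case: (posnP (reds t N)) => [rN|rN]; first by rewrite card_circles_A // rN.
have [m tm] := ex_red_r r0 rN.
have F := split_fused_r h1_gt0 h2_gt0 tm ltac:(by rewrite r0 orbT).
have E1 := @reds_removed _ t _ h1 tm; have E2 := @reds_removed _ t _ N tm.
rewrite /= ltn_add2l ltn_ord in E2.
by rewrite (fused_card F) IH //; lia.
Qed.

Lemma card_circles t : (0 < reds t h1)%N -> (reds t h1 < reds t N)%N ->
  (#|circles t|.+1 = reds t N)%N.
Proof.
have [n] := ubnP (reds t h1); elim: n t => // n IH t tn r1 r2.
have [k tk] := ex_red_l r1.
have E1 := @reds_removed _ t _ h1 tk; have E2 := @reds_removed _ t _ N tk.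
rewrite /= ltn_ord in E1; rewrite /= ltn_addr // in E2.
case: (ltnP 1 (reds t h1)) => c.
  by rewrite (fused_card (split_fused_l h1_gt0 h2_gt0 tk c r2)) IH //; lia.
have F := merge_fused_l h1_gt0 h2_gt0 tk ltac:(lia) ltac:(lia).
by rewrite -(fused_card F) card_circles_empty_l; lia.
Qed.

Section Telescope.
Variables (T : estate D) (e : arc D).
Local Notation t := (lab T).
Local Notation term x := ((-1) ^+ reds t x *+
     @adjacent_at D x (minus_at (removed t x) (circle_through (removed t x) e)) T).
Let f (p : arc D) k : int := (-1) ^+ reds t k *+ two_minus T e p.

(** At a red step the sign changes from one side to the other, so the sum of
    [split_minus_at] becomes a difference; across a blue one nothing changes. *)
Lemma telescope_step (x : 'I_(ncro D)) (p p' : arc D) :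
    (if t x then fused t (removed t x) p p' else p' \in circle_through t p) ->
  (if t x then term x else 0) = - (f p' x.+1 - f p x).
Proof.
rewrite /f (@redsS D t x); case: ifP => tx H.
  by rewrite (split_minus_at e tx H) addn1 exprS mulN1r mulNrn opprB opprK mulrnDr.
by rewrite addn0 (two_minus_eq e H) subrr oppr0.
Qed.

Lemma telescope_l :
    (forall k : 'I_h1, t (lshift h2 k) ->
       fused t (removed t (lshift h2 k)) (top k) (top k.+1)) ->
  \sum_(k : 'I_h1 | t (lshift h2 k)) term (lshift h2 k) = f (top 0) 0 - f (top h1) h1.
Proof.
move=> H; rewrite big_mkcond /= -opprB -(telescope_sumr (fun k => f (top k) k)) //.
rewrite -sumrN big_mkord; apply: eq_bigr => k _.
apply: (@telescope_step (lshift h2 k)); case: ifP => [/H //|tk].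
have [] // := @no_reds_l h1 h2 h1_gt0 h2_gt0 t k k.+1; first by rewrite leqnSn ltn_ord.
by rewrite (redsS t (lshift h2 k)) tk addn0.
Qed.

Lemma telescope_r :
    (forall m : 'I_h2, t (rshift h1 m) ->
       fused t (removed t (rshift h1 m)) (lft m) (lft m.+1)) ->
  \sum_(m : 'I_h2 | t (rshift h1 m)) term (rshift h1 m) = f (lft 0) h1 - f (lft h2) N.
Proof.
move=> H; have -> : f (lft 0) h1 = f (lft 0) (h1 + 0)%N by rewrite addn0.
rewrite big_mkcond /=.
rewrite -opprB -(telescope_sumr (fun m => f (lft m) (h1 + m))) //.
rewrite -sumrN big_mkord; apply: eq_bigr => m _; rewrite addnS.
apply: (@telescope_step (rshift h1 m)); case: ifP => [/H //|tm].
have [] // := @no_reds_r h1 h2 h1_gt0 h2_gt0 t m m.+1; first by rewrite leqnSn ltn_ord.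
by rewrite addnS (redsS t (rshift h1 m)) tm addn0.
Qed.

End Telescope.

Lemma two_minus_same T e u : u \in circle_through (lab T) e -> two_minus T e u = false.
Proof. by rewrite /two_minus => ->. Qed.

Lemma dif_minus_sum_outer m1 m2 : (0 < m1)%N -> (0 < m2)%N -> dif (minus_sum m1 m2 (top 0)) = 0.
Proof.
move=> m1_gt0 m2_gt0; apply/ffunP=> T; rewrite dif_minus_sum [RHS]ffunE.
set t := lab T.
have Z : (0 < reds t h1)%N -> (reds t h1 < reds t N)%N ->
  [/\ two_minus T (top 0) (top 0) = false, two_minus T (top 0) (top h1) = false
    & two_minus T (top 0) (lft h2) = false].
  move=> r1 r2; have [c1 c2 c3] := corners_circle h1_gt0 h2_gt0 r1 r2.
  by rewrite lft_h2 //; split; apply: two_minus_same => //; exact: mem_circle_self.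
case: (boolP (ranks m1.+1 m2 t)) => [P1|_].
  have /andP[/eqP r1 /eqP r2] := P1.
  rewrite [X in _ + X]big_pred0 ?addr0; last by move=> k; rewrite /ranks r1 (gtn_eqF (ltnSn m1)) andbF.
  have [||Z1 Z2 _] := Z; [lia|lia|].
  under eq_bigl do rewrite andbT.
  rewrite telescope_l ?Z1 ?Z2 ?subrr // => k tk.
  by apply: split_fused_l => //; rewrite -/t; lia.
rewrite big_pred0 ?add0r; last by move=> k; rewrite andbF.
case: (boolP (ranks m1 m2.+1 t)) => [P1|_]; last by rewrite big_pred0 // => k; rewrite andbF.
have /andP[/eqP r1 /eqP r2] := P1.
have [||_ Z1 Z2] := Z; [lia|lia|].
under eq_bigl do rewrite andbT.
rewrite telescope_r ?lft0 ?Z1 ?Z2 ?subrr // => k tk.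
by apply: split_fused_r => //; rewrite -/t; lia.
Qed.

(** Here [lft 0] and [lft h2] are on the two circles of the source, which the
    first ladder merges and the second one splits further. *)
Lemma dif_minus_sum_cap e T : e = lft 0 \/ e = lft h2 -> let t := lab T in
  dif (minus_sum 0 1 e) T =
  (ranks 1 1 t && (T == minus_at t (circle_through t (top 0))))%:R
  + (ranks 0 2 t)%:R *
    ((two_minus T e (lft 0))%:R - (two_minus T e (lft h2))%:R).
Proof.
move=> eE t; rewrite dif_minus_sum -/t; congr (_ + _).
  case: (boolP (ranks 1 1 t)) => [P1|_]; last by rewrite big_pred0 // => k; rewrite andbF.
  have /andP[/eqP r1 /eqP r2] := P1.
  have [k tk] := @ex_red_l t ltac:(by rewrite r1).
  have mon := @reds_le _ t.
  have uniq_red k' : t (lshift h2 k') = (k' == k).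
    apply/idP/eqP=> [tk'|->//]; apply/val_inj/eqP; rewrite /= eqn_leq.
    have := mon k.+1 h1 (ltn_ord k); have := mon k'.+1 h1 (ltn_ord k').
    have := @redsS D t (lshift h2 k); have := @redsS D t (lshift h2 k').
    rewrite tk tk' r1 /=; have := mon k'.+1 k; have := mon k.+1 k'; lia.
  rewrite (big_pred1 k) => [|k']; last by rewrite andbT uniq_red.
  have F := merge_fused_l h1_gt0 h2_gt0 tk r1 ltac:(by rewrite r2).
  have r0 : reds t k = 0%N.
    have := mon k.+1 h1 (ltn_ord k); have := @redsS D t (lshift h2 k).
    by rewrite tk r1 /=; lia.
  rewrite /= r0 expr0 (merge_minus_at tk F).
    rewrite lft0 (circle_eq (_ : top h1 \on circle_through t (top 0))) //.
    by have [] := @corners_circle h1 h2 h1_gt0 h2_gt0 t; rewrite ?r1 ?r2.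
  by case: eE => ->; rewrite in_setU mem_circle_self ?orbT.
case: (boolP (ranks 0 2 t)) => [P1|_]; last by rewrite mul0r big_pred0 // => k; rewrite andbF.
have /andP[/eqP r1 /eqP r2] := P1.
under eq_bigl do rewrite andbT.
rewrite telescope_r -/t ?r1 ?r2 ?mul1r // => k tk.
by apply: split_fused_r => //; rewrite -/t r1 orbT.
Qed.

Lemma ffunD_at (c c' : chain D) T : (c + c') T = c T + c' T.
Proof. by rewrite ffunE. Qed.

Lemma dif_minus_sum_caps :
  dif (minus_sum 0 1 (lft 0) + minus_sum 0 1 (lft h2)) = minus_sum 1 1 (top 0) *+ 2.
Proof.
apply/ffunP=> T.
have W0 := @dif_minus_sum_cap (lft 0) T ltac:(by left).
have W1 := @dif_minus_sum_cap (lft h2) T ltac:(by right).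
cbv zeta in W0, W1.
rewrite difD.
rewrite ffunD_at.
apply: (etrans (congr2 +%R W0 W1)).
rewrite ffunMnE.
rewrite minus_sumE mulr2n (two_minusC T (lft h2) (lft 0)).
rewrite ![two_minus T ?[x] ?x]two_minus_same ?mem_circle_self //.
ring.
Qed.

End Chains.

(** * States described by their sets of red steps *)

Section RedSteps.
Variables h1 h2 : nat.
Local Notation D := (mono h1 h2).
Local Notation N := (h1 + h2)%N.
Local Notation top := (top h1 h2).
Implicit Types (s t : kstate D) (S T : estate D).

Lemma red_steps_l (M1 : {set 'I_h1}) (M2 : {set 'I_h2}) k :
  red_steps M1 M2 (lshift h2 k) = (k \in M1).
Proof. by rewrite ffunE (unsplitK (inl k)). Qed.

Lemma red_steps_r (M1 : {set 'I_h1}) (M2 : {set 'I_h2}) m :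
  red_steps M1 M2 (rshift h1 m) = (m \in M2).
Proof. by rewrite ffunE (unsplitK (inr m)). Qed.

Lemma red_steps_bij : bijective (fun M : {set 'I_h1} * {set 'I_h2} => red_steps M.1 M.2).
Proof.
exists (fun s : kstate D => ([set k | s (lshift h2 k)], [set m | s (rshift h1 m)])).
  case=> M1 M2; congr (_, _); apply/setP=> k; rewrite inE.
    exact: red_steps_l.
  exact: red_steps_r.
move=> s; apply/ffunP=> x; case: (split_ordP x) => k ->.
  by rewrite red_steps_l inE.
by rewrite red_steps_r inE.
Qed.

Lemma reds_sum s k : reds s k = (\sum_(x < N) ((x < k) && s x))%N.
Proof.
rewrite /reds -sum1_card [LHS]big_mkcond /=; apply: eq_bigr => x _.
by rewrite inE; case: (_ && _).
Qed.

Lemma reds_red_steps (M1 : {set 'I_h1}) (M2 : {set 'I_h2}) :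
  reds (red_steps M1 M2) h1 = #|M1| /\ reds (red_steps M1 M2) N = (#|M1| + #|M2|)%N.
Proof.
rewrite !reds_sum !big_split_ord /=; split.
  rewrite [X in (_ + X)%N]big1 => [|m _]; last by rewrite ltnNge leq_addr.
  rewrite addn0 -sum1_card [RHS]big_mkcond; apply: eq_bigr => k _.
  by rewrite ltn_ord red_steps_l; case: (_ \in _).
rewrite -!sum1_card; congr (_ + _)%N; rewrite [RHS]big_mkcond; apply: eq_bigr => k _.
  by rewrite ltn_addr // red_steps_l; case: (_ \in _).
by rewrite ltn_add2l ltn_ord red_steps_r; case: (_ \in _).
Qed.

Lemma first_step_le h (M : {set 'I_h}) : (first_step M <= h)%N.
Proof. by rewrite -[h in (_ <= h)%N](size_enum_ord h) find_size. Qed.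

Lemma before_first_step h (M : {set 'I_h}) (k : 'I_h) : (k < first_step M)%N -> k \notin M.
Proof. by move/(before_find k); rewrite nth_ord_enum => ->. Qed.

Definition ramp m1 m2 : kstate D := [ffun x : 'I_N => (x < m1)%N || (h1 <= x < h1 + m2)%N].

Lemma reds_ramp m1 m2 k : (m1 <= h1)%N -> (k <= N)%N ->
  reds (ramp m1 m2) k = (minn k m1 + minn (k - h1) m2)%N.
Proof.
move=> mh; elim: k => [|k IH] kN; first by rewrite reds0; lia.
rewrite (@redsS D _ (Ordinal kN)) /= IH; last exact: ltnW.
rewrite ffunE /=; lia.
Qed.

Hypotheses (h1_gt0 : (0 < h1)%N) (h2_gt0 : (0 < h2)%N).

Lemma C10_outer (M1 : {set 'I_h1}) (M2 : {set 'I_h2}) :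
  C10 M1 M2 = circle_through (red_steps M1 M2) (top 0).
Proof.
have fh := first_step_le M1.
case: (@no_reds_l h1 h2 h1_gt0 h2_gt0 (red_steps M1 M2) 0 (first_step M1)) => //.
  apply: reds_const => // x; case: (split_ordP x) => k -> /=.
    by rewrite red_steps_l; exact: before_first_step.
  by lia.
by move=> /circle_eq ->.
Qed.

Lemma C20_outer (M1 : {set 'I_h1}) (M2 : {set 'I_h2}) : (0 < #|M1|)%N -> (0 < #|M2|)%N ->
  C20 M1 M2 = circle_through (red_steps M1 M2) (top 0).
Proof.
move=> M1_gt0 M2_gt0; have fh := first_step_le M2.
have [r1 r2] := reds_red_steps M1 M2.
have [c _ _] := @corners_circle h1 h2 h1_gt0 h2_gt0 (red_steps M1 M2) ltac:(lia) ltac:(lia).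
rewrite (circle_eq c) -lft0.
case: (@no_reds_r h1 h2 h1_gt0 h2_gt0 (red_steps M1 M2) 0 (first_step M2)) => //.
  rewrite addn0; apply: reds_const => [|x]; first exact: leq_addr.
  case: (split_ordP x) => k -> /=; first by have := ltn_ord k; lia.
  by rewrite red_steps_r ltn_add2l leq_addr; exact: before_first_step.
by move=> /circle_eq ->.
Qed.

Lemma sum_red_steps m1 m2 (C : {set 'I_h1} -> {set 'I_h2} -> {set arc D}) :
    (forall (M1 : {set 'I_h1}) (M2 : {set 'I_h2}), #|M1| = m1 -> #|M2| = m2 ->
       C M1 M2 = circle_through (red_steps M1 M2) (top 0)) ->
  \sum_(M1 : {set 'I_h1} | #|M1| == m1) \sum_(M2 : {set 'I_h2} | #|M2| == m2)
    gen (minus_at (red_steps M1 M2) (C M1 M2)) = minus_sum m1 m2 (top 0).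
Proof.
move=> H; rewrite pair_big /minus_sum.
rewrite [RHS](reindex _ (onW_bij _ red_steps_bij)).
apply: eq_big => [[M1 M2]|[M1 M2] /andP[/eqP c1 /eqP c2]].
  rewrite /ranks; have [-> ->] /= := reds_red_steps M1 M2.
  by case: eqP => //= ->; rewrite eqn_add2l.
by rewrite H.
Qed.

Lemma sC10E m1 m2 : sC10 h1 h2 m1 m2 = minus_sum m1 m2 (top 0).
Proof. by apply: sum_red_steps => M1 M2 _ _; apply: C10_outer. Qed.

Lemma sC20E m1 m2 : (0 < m1)%N -> (0 < m2)%N -> sC20 h1 h2 m1 m2 = minus_sum m1 m2 (top 0).
Proof. by move=> p1 p2; apply: sum_red_steps => M1 M2 c1 c2; apply: C20_outer; rewrite ?c1 ?c2. Qed.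

End RedSteps.

(** * A mod 2 linear form vanishing on boundaries *)

Section Pairing.
Variable D : diagram.
Implicit Types (t : kstate D) (S T : estate D) (u v : arc D).

Lemma card_minus_split t S u v b1 b2 : fused t (lab S) u v ->
  (#|minus (split_estate t u v b1 b2 S)| + ~~ sgn S u = #|minus S| + ~~ b1 + ~~ b2)%N.
Proof.
move=> F; have := @fused_minus _ S (split_estate t u v b1 b2 S) u v F.
rewrite !(sgn_split_estate F) !mem_circle_self (negbTE F.1); apply=> e.
by rewrite in_setU negb_or (sgn_split_estate F) => /andP[/negbTE-> /negbTE->].
Qed.

Lemma card_minus_merge t S u v : fused (lab S) t u v ->
  (#|minus S| + ~~ (sgn S u && sgn S v) = #|minus (merge_estate t S u v)| + ~~ sgn S u + ~~ sgn S v)%N.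
Proof.
move=> F; have := @fused_minus _ (merge_estate t S u v) S u v F.
rewrite !(sgn_merge_estate F) !mem_circle_self; apply=> e We.
by rewrite (sgn_merge_estate F) (fused_u F) (negbTE We).
Qed.

Definition pairing (g : estate D -> 'F_2) (c : chain D) : 'F_2 :=
  \sum_T (c T)%:~R * g T.

Lemma F2_sign n : (-1) ^+ n = 1 :> 'F_2.
Proof. by rewrite (_ : -1 = 1) ?expr1n //; apply/eqP. Qed.

Lemma F2_double (a : 'F_2) : a + a = 0.
Proof. by rewrite -mulr2n -mulr_natr (_ : 2%:R = 0) ?mulr0 //; apply/eqP. Qed.

Lemma pairing_dif g c : pairing g (dif c) =
  \sum_S (c S)%:~R * \sum_x \sum_(T | adjacent_at x S T) g T.
Proof.
rewrite /pairing.
under eq_bigr => T _.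
  rewrite ffunE rmorph_sum mulr_suml /=.
  under eq_bigr do rewrite rmorphM -mulrA.
  over.
rewrite exchange_big /=; apply: eq_bigr => S _.
rewrite -mulr_sumr; congr (_ * _); rewrite [RHS](exchange_big_dep predT) //=.
apply: eq_bigr => T _; rewrite rmorph_sum mulr_suml; apply: eq_bigr => x _.
by rewrite rmorphXn rmorphN1 F2_sign mul1r.
Qed.

Lemma pairingB g c c' : pairing g (c - c') = pairing g c - pairing g c'.
Proof.
rewrite /pairing -sumrB; apply: eq_bigr => T _.
by rewrite !ffunE rmorphB mulrBl.
Qed.

(** The crossing is determined by the labels of [S] and [t], so that the right
    hand side has at most one term. *)
Lemma coboundary_at t (g : estate D -> 'F_2) S :
  \sum_x \sum_(T | adjacent_at x S T) (if lab T == t then g T else 0) =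
  \sum_(x | t x && (lab S == removed t x)) \sum_(T | adjacent_at x S T) g T.
Proof.
rewrite [RHS]big_mkcond /=; apply: eq_bigr => x _; case: ifP => [/andP[tx /eqP lS]|n].
  apply: eq_bigr => T h; have [Tx lT] := adjacent_lab h.
  by rewrite (_ : lab T = t) ?eqxx //; apply: (@removed_inj _ x) => //; rewrite -lT.
rewrite big1 // => T h; case: eqP => // lTt; have [Tx lT] := adjacent_lab h.
by rewrite -lTt Tx lT eqxx in n.
Qed.

Section Local.
Variables (t : kstate D) (S : estate D) (u v : arc D) (x : 'I_(ncro D)).
Hypotheses (tx : t x) (lS : lab S = removed t x).

Lemma merge_one_minus : fused (lab S) t u v ->
  \sum_(T | adjacent_at x S T) (#|minus T| == 1)%:R = (#|minus S| == 1)%:R :> 'F_2.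
Proof.
move=> F; rewrite (merge_sum F) //; have := card_minus_merge F.
case: (boolP (sgn S u)) => s0; case: (boolP (sgn S v)) => s1 E.
- by rewrite (_ : #|minus S| = #|minus (merge_estate t S u v)|) //; lia.
- by rewrite (_ : #|minus S| = #|minus (merge_estate t S u v)|) //; lia.
- by rewrite (_ : #|minus S| = #|minus (merge_estate t S u v)|) //; lia.
by have := minus_gt1 s0 s1 F.1; case: #|_| => [|[|n]].
Qed.

Hypothesis F : fused t (lab S) u v.

(** If the circle which splits has sign plus there are two targets, each with one
    more minus circle than [S]; if it has sign minus, the targets have at least
    two minus circles. *)
Lemma split_one_minus :
  \sum_(T | adjacent_at x S T) (#|minus T| == 1)%:R = 0 :> 'F_2.
Proof.
rewrite (split_sum F) //; have cm b1 b2 := card_minus_split b1 b2 F.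
case: ifP => [s1|/negbT s0].
  have := cm true false; have := cm false true; rewrite s1 !addn0 => -> ->.
  exact: F2_double.
have := minus_gt0 s0; have := cm false false; rewrite s0 => E1 E2.
by rewrite (_ : (_ == 1%N) = false) //; lia.
Qed.

(** The two targets of a plus circle agree at [f]; if the circle which splits and
    that of [f] are both minus, the target has at least three minus circles. *)
Lemma split_two_minus_out f :
    f \notin circle_through t u :|: circle_through t v ->
  \sum_(T | adjacent_at x S T) ((#|minus T| == 2) && ~~ sgn T f)%:R = 0 :> 'F_2.
Proof.
move=> out; have := out; rewrite in_setU negb_or => /andP[o1 o2].
rewrite (split_sum F) //; have cm b1 b2 := card_minus_split b1 b2 F.
have sE b1 b2 : sgn (split_estate t u v b1 b2 S) f = sgn S f.
  by rewrite (sgn_split_estate F) (negbTE o1) (negbTE o2).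
rewrite !sE; case: ifP => [s1|/negbT s0].
  have := cm true false; have := cm false true; rewrite s1 !addn0 => -> ->.
  exact: F2_double.
case: (boolP (sgn S f)) => [_|s1]; first by rewrite andbF.
have := minus_gt1 s0 s1; rewrite (fused_u F) => /(_ out) g1.
have := cm false false; rewrite s0 => /addIn E1.
by rewrite (_ : (_ == 2%N) = false) //; lia.
Qed.

(** Of the two targets of a plus circle only one is minus at [f], and it has one
    more minus circle than [S], as has the only target of a minus circle. *)
Lemma split_two_minus_in f : f \in circle_through t v ->
  \sum_(T | adjacent_at x S T) ((#|minus T| == 2) && ~~ sgn T f)%:R
    = (#|minus S| == 1)%:R :> 'F_2.
Proof.
move=> c; rewrite (split_sum F) //; have cm b1 b2 := card_minus_split b1 b2 F.
have sE b1 b2 : sgn (split_estate t u v b1 b2 S) f = b2.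
  rewrite (sgn_split_estate F) (same_circle _ c) (negbTE F.1) c //.
rewrite !sE /= andbT andbF addr0.
case: ifP => [s1|/negbT s0].
  by have := cm true false; rewrite s1 addn0 addn0 addn1 => ->; rewrite eqSS.
by have := cm false false; rewrite s0 => /addIn ->; rewrite addn1 eqSS andbT.
Qed.

End Local.

End Pairing.

Section Detect.
Variables h1 h2 : nat.
Hypotheses (h1_gt0 : (0 < h1)%N) (h2_gt0 : (0 < h2)%N).
Local Notation D := (mono h1 h2).
Local Notation N := (h1 + h2)%N.
Local Notation lft := (lft h1 h2).
Local Notation "a \on C" := (@in_mem (arc D) a (mem C)) (at level 70).
Implicit Types (s t : kstate D) (S T : estate D).
Local Notation ramp := (ramp h1 h2).
Variable m : nat.
Hypotheses (m_gt1 : (1 < m)%N) (m_lt : (m < h2)%N).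

(* The arc [lft h2] marks the far end of the second ladder. *)
Definition one_minus_weight T : 'F_2 := (#|minus T| == 1)%:R.
Definition two_minus_weight T : 'F_2 := ((#|minus T| == 2) && ~~ sgn T (lft h2))%:R.
Definition weight T : 'F_2 :=
  (if lab T == ramp 1 m then one_minus_weight T else 0)
  + (if lab T == ramp 0 m.+1 then two_minus_weight T else 0).

(* From [ramp 0 m], [crossing1] leads to [ramp 1 m] by a merging and [crossing0]
   to [ramp 0 m.+1] by a splitting. *)
Let crossing1 : 'I_(ncro D) := lshift h2 (Ordinal h1_gt0).
Let crossing0 : 'I_(ncro D) := rshift h1 (Ordinal m_lt).

Lemma removed_crossing1 : ramp 1 m crossing1 /\ removed (ramp 1 m) crossing1 = ramp 0 m.
Proof.
split; first by rewrite ffunE.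
apply/ffunP=> y; rewrite removedE !ffunE -val_eqE /=; lia.
Qed.

Lemma removed_crossing0 : ramp 0 m.+1 crossing0 /\ removed (ramp 0 m.+1) crossing0 = ramp 0 m.
Proof.
split; first by rewrite ffunE /=; lia.
apply/ffunP=> y; rewrite removedE !ffunE -val_eqE /=; lia.
Qed.

Let coboundary S : 'F_2 := if lab S == ramp 0 m then (#|minus S| == 1)%:R else 0.

Lemma coboundary_one_minus S :
  \sum_x \sum_(T | adjacent_at x S T) (if lab T == ramp 1 m then one_minus_weight T else 0) =
  coboundary S.
Proof.
rewrite coboundary_at (bigID (pred1 crossing1)) /= [X in _ + X]big1 ?addr0.
  have [t1 r1] := removed_crossing1; rewrite /coboundary -r1.
  case: ifP => [/eqP lS|n]; last first.
    by rewrite big_pred0 // => x; case: (x =P crossing1) => [->|]; rewrite ?n ?andbF.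
  rewrite (big_pred1 crossing1) => [|x]; last first.
    by rewrite /= andbC; case: (x =P crossing1) => //= ->; rewrite t1 lS eqxx.
  have F : fused (lab S) (ramp 1 m) (lft 0) (lft h2).
    by rewrite lS; apply: merge_fused_l => //; rewrite reds_ramp //; lia.
  exact: (merge_one_minus t1 lS F).
move=> x /andP[/andP[tx /eqP lS] nx].
have [k xE] : exists k, x = rshift h1 k.
  case: (split_ordP x) => k xE; last by exists k.
  by move: tx nx; rewrite xE ffunE /= -val_eqE /=; have := ltn_ord k; lia.
have F : fused (ramp 1 m) (lab S) (lft k) (lft k.+1).
  rewrite lS xE; apply: split_fused_r => //; first by rewrite -xE.
  by rewrite !reds_ramp //; lia.
exact: (@split_one_minus D (ramp 1 m) S (lft k) (lft k.+1) x tx lS F).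
Qed.

Lemma ramp0_circle i j : (i <= h2)%N -> (j <= h2)%N ->
  lft i \on circle_through (ramp 0 m.+1) (lft j) -> minn i m.+1 = minn j m.+1.
Proof.
move=> ih jh c.
have [|psi [_ P inv]] := @invariant_empty_l h1 h2 h1_gt0 h2_gt0 (ramp 0 m.+1).
  by rewrite reds_ramp //; lia.
have := inv _ _ c; rewrite !P // !reds_ramp //; lia.
Qed.

Lemma coboundary_two_minus S :
  \sum_x \sum_(T | adjacent_at x S T) (if lab T == ramp 0 m.+1 then two_minus_weight T else 0) =
  coboundary S.
Proof.
have Fk (k : 'I_h2) : ramp 0 m.+1 (rshift h1 k) ->
    fused (ramp 0 m.+1) (removed (ramp 0 m.+1) (rshift h1 k)) (lft k) (lft k.+1).
  by move=> tk; apply: split_fused_r => //; rewrite !reds_ramp //; lia.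
rewrite coboundary_at (bigID (pred1 crossing0)) /= [X in _ + X]big1 ?addr0.
  have [t1 r1] := removed_crossing0; rewrite /coboundary -r1.
  case: ifP => [/eqP lS|n]; last first.
    by rewrite big_pred0 // => x; case: (x =P crossing0) => [->|]; rewrite ?n ?andbF.
  rewrite (big_pred1 crossing0) => [|x]; last first.
    by rewrite /= andbC; case: (x =P crossing0) => //= ->; rewrite t1 lS eqxx.
  have F : fused (ramp 0 m.+1) (lab S) (lft m) (lft m.+1) by rewrite lS; exact: Fk.
  have c : lft h2 \on circle_through (ramp 0 m.+1) (lft m.+1).
    by case: (@no_reds_r h1 h2 h1_gt0 h2_gt0 (ramp 0 m.+1) m.+1 h2) => //;
       rewrite ?reds_ramp //; lia.
  exact: (split_two_minus_in t1 lS F c).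
move=> x /andP[/andP[tx /eqP lS] nx].
have [k xE] : exists k, x = rshift h1 k.
  case: (split_ordP x) => k xE; last by exists k.
  by move: tx nx; rewrite xE ffunE /= -val_eqE /=; have := ltn_ord k; lia.
have km : (k < m)%N.
  by move: tx nx; rewrite xE ffunE -val_eqE /=; lia.
have F : fused (ramp 0 m.+1) (lab S) (lft k) (lft k.+1).
  by rewrite lS xE; apply: Fk; rewrite -xE.
have out : lft h2 \notin circle_through (ramp 0 m.+1) (lft k)
    :|: circle_through (ramp 0 m.+1) (lft k.+1).
  by apply/negP; rewrite in_setU => /orP[] /ramp0_circle; have := ltn_ord k; lia.
exact: (@split_two_minus_out D (ramp 0 m.+1) S (lft k) (lft k.+1) x tx lS F _ out).
Qed.

(** Both parts of the weight have the same coboundary, and 2 = 0. *)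
Lemma pairing_weight_dif (c : chain D) : pairing weight (dif c) = 0.
Proof.
rewrite pairing_dif big1 // => S _; apply/eqP; rewrite mulf_eq0; apply/orP; right; apply/eqP.
under eq_bigr do rewrite big_split /=.
by rewrite big_split /= coboundary_one_minus coboundary_two_minus F2_double.
Qed.

Lemma pairing_minus_sum m1 m2 e :
  pairing weight (minus_sum m1 m2 e) = (ranks m1 m2 (ramp 1 m))%:R.
Proof.
rewrite /pairing (bigD1 (minus_at (ramp 1 m) (circle_through (ramp 1 m) e)) isT) big1.
  apply: etrans (addr0 _) _.
  rewrite minus_sumE eqxx andbT /weight eqxx /one_minus_weight minus_minus_at cards1 eqxx ifF ?addr0.
    by case: (ranks _ _ _); rewrite ?mul0r ?mul1r.
  apply/negP=> /eqP/ffunP/(_ crossing1); rewrite !ffunE /=; lia.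
move=> T /andP[_ nT]; rewrite minus_sumE; case: eqP => TE; last by rewrite andbF mul0r.
have mT : #|minus T| = 1%N by rewrite TE minus_minus_at cards1.
rewrite /weight /two_minus_weight mT; case: eqP => lT.
  by move: nT; rewrite TE lT eqxx.
by rewrite add0r; case: ifP; rewrite ?mulr0.
Qed.

End Detect.

(** * Comparing the homology classes *)

Section Classes.
Variable D : diagram.

Lemma cycle_defines (c : chain D) i j :
  c \in chains i j -> dif c = 0 -> exists k : Kh D i j, defines c k.
Proof.
move=> ch dc; have cc : c \in cycles i j by apply/andP; rewrite dc.
by exists (\pi_(Kh D i j)%qT (Cycle cc)), (Cycle cc).
Qed.

Lemma cycle_chainB i j (z z' : kcycle D i j) :
  cycle_chain (z - z') = cycle_chain z - cycle_chain z'.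
Proof. exact: (raddfB (\val : kcycle D i j -> chain D)). Qed.

Lemma defines_same (c c' : chain D) i j :
  (exists k : Kh D i j, defines c k /\ defines c' k) <->
  [/\ c \in cycles i j, c' \in cycles i j
    & exists2 b, b \in chains (i - 1) j & dif b = c - c'].
Proof.
split=> [[k [[z [zc zk]] [z' [zc' zk']]]]|[cc cc' [b bc db]]].
  have : z - z' \in @boundaries D i j.
    by rewrite Quotient.idealrBE zk zk'.
  case/asboolP=> b bc; rewrite cycle_chainB zc zc' => db.
  by split; [rewrite -zc; case: (z)|rewrite -zc'; case: (z')|exists b].
exists (\pi_(Kh D i j)%qT (Cycle cc)); split; first by exists (Cycle cc).
exists (Cycle cc'); split=> //; apply/esym/eqP.
rewrite -Quotient.idealrBE; apply/asboolP; exists b => //.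
Qed.

End Classes.

Section Main.
Variables h1 h2 : nat.
Hypotheses (h1_gt0 : (0 < h1)%N) (h2_gt0 : (0 < h2)%N).
Local Notation D := (mono h1 h2).
Local Notation N := (h1 + h2)%N.
Local Notation V m1 m2 := (minus_sum m1 m2 (top h1 h2 0)).

Lemma minus_sum_outer_chains m1 m2 i j : (0 < m1)%N -> (0 < m2)%N ->
  i = (m1 + m2)%:Z -> j = 2 * (m1 + m2)%:Z - 3 -> V m1 m2 \in chains i j.
Proof.
move=> p1 p2 -> ->.
have := @minus_sum_chains h1 h2 m1 m2 (top h1 h2 0) (m1 + m2)%N (m1 + m2).-1.
rewrite (_ : _ + _ - 2 = 2 * (m1 + m2)%:Z - 3 :> int); last lia.
apply=> // s /andP[/eqP r1 /eqP r2].
by have := @card_circles h1 h2 h1_gt0 h2_gt0 s; rewrite r1 r2; lia.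
Qed.

(** The chain is not zero, so it lies in only one degree. *)
Lemma minus_sum_degree m1 m2 i j : (m1 <= h1)%N -> (m2 <= h2)%N ->
  V m1 m2 \in chains i j -> i = (m1 + m2)%:Z.
Proof.
move=> l1 l2 /forallP/(_ (minus_at (ramp h1 h2 m1 m2)
  (circle_through (ramp h1 h2 m1 m2) (top h1 h2 0)))).
have P : ranks m1 m2 (ramp h1 h2 m1 m2) by rewrite /ranks !reds_ramp //; lia.
rewrite minus_sumE P eqxx /= => /andP[/eqP <- _].
by rewrite ideg_reds; have /andP[_ /eqP ->] := P.
Qed.

End Main.

Theorem proposition15 (h1 h2 mu mu' : nat)
    (h1_ge2 : (2 <= h1)%N) (h2_ge2 : (2 <= h2)%N)
    (mu_odd : odd mu) (mu'_odd : odd mu')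
    (mu_bound : (1 <= mu < h1)%N) (mu'_bound : (1 <= mu' < h2)%N) :
  [/\ exists a : Kh (mono h1 h2) (mu%:Z + 1) (2 * mu%:Z - 1),
        defines (Vl h1 h2 mu) a,
      exists b : Kh (mono h1 h2) (mu'%:Z + 1) (2 * mu'%:Z - 1),
        defines (Vr h1 h2 mu') b
    & (exists (i j : int) (k : Kh (mono h1 h2) i j),
         defines (Vl h1 h2 mu) k /\ defines (Vr h1 h2 mu') k)
      <-> (mu = 1%N /\ mu' = 1%N)].
Proof.
have h1_gt0 : (0 < h1)%N := ltnW h1_ge2.
have h2_gt0 : (0 < h2)%N := ltnW h2_ge2.
have /andP[mu_gt0 mu_lt] := mu_bound; have /andP[mu'_gt0 mu'_lt] := mu'_bound.
pose V (m1 m2 : nat) : chain (mono h1 h2) := minus_sum m1 m2 (top h1 h2 0).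
have VlE : Vl h1 h2 mu = - V mu 1%N.
  by rewrite /Vl sC10E // -signr_odd mu_odd expr1 mulrN1z.
have VrE : Vr h1 h2 mu' = V 1%N mu' by rewrite /Vr sC20E.
have Vl_chains i j : i = mu%:Z + 1 -> j = 2 * mu%:Z - 1 -> - V mu 1%N \in chains i j.
  by move=> -> ->; rewrite rpredN; apply: minus_sum_outer_chains => //; lia.
have Vr_chains i j : i = mu'%:Z + 1 -> j = 2 * mu'%:Z - 1 -> V 1%N mu' \in chains i j.
  by move=> -> ->; apply: minus_sum_outer_chains => //; lia.
have dVl : dif (- V mu 1%N) = 0 by rewrite raddfN /= dif_minus_sum_outer // oppr0.
have dVr : dif (V 1%N mu') = 0 by rewrite dif_minus_sum_outer.
rewrite VlE VrE; split.
- by apply: cycle_defines dVl; apply: Vl_chains.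
- by apply: cycle_defines dVr; apply: Vr_chains.
split=> [[i [j /defines_same[/andP[cl _] /andP[cr _] [b _ db]]]]|[E E']].
  have mu'1 : mu' = 1%N.
    apply/eqP; apply: contraT => n1; have mu'_gt1 : (1 < mu')%N by lia.
    have := pairing_weight_dif h1_gt0 h2_gt0 mu'_gt1 mu'_lt b.
    rewrite db pairingB -[- V mu 1%N]sub0r pairingB.
    have p0 : pairing (weight mu') (0 : chain (mono h1 h2)) = 0.
      by rewrite /pairing big1 // => T _; rewrite ffunE mul0r.
    rewrite p0 !pairing_minus_sum //.
    have -> : ranks 1 mu' (ramp h1 h2 1 mu') by rewrite /ranks !reds_ramp //; lia.
    have -> : ranks mu 1 (ramp h1 h2 1 mu') = false by rewrite /ranks !reds_ramp //; lia.
    by move/eqP.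
  split=> //; rewrite rpredN in cl.
  have := minus_sum_degree h1_gt0 h2_gt0 (ltnW mu_lt) (ltnW h2_ge2) cl.
  have := minus_sum_degree h1_gt0 h2_gt0 (ltnW h1_ge2) (ltnW mu'_lt) cr.
  by rewrite mu'1 => -> [] /addIn.
rewrite E E' in Vl_chains Vr_chains dVl dVr *.
exists 2, 1; apply/defines_same; split.
- by apply/andP; rewrite dVl eqxx Vl_chains.
- by apply/andP; rewrite dVr eqxx Vr_chains.
exists (- (minus_sum 0 1 (lft h1 h2 0) + minus_sum 0 1 (lft h1 h2 h2))).
  have W (e : arc (mono h1 h2)) : minus_sum 0 1 e \in chains (2 - 1 : int) 1.
    have := @minus_sum_chains h1 h2 0 1 e 1 2.
    apply=> // s /andP[/eqP r1 /eqP r2]; rewrite card_circles_empty_l // r2 //.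
  by rewrite rpredN rpredD.
by rewrite raddfN /= dif_minus_sum_caps // mulr2n opprD.
Qed.
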